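(* Let $n\ge 2$, let $G$ be the $1$-skeleton of a triangulation of a convex $(n+2)$-gon (the $n+2$ sides together with $n-1$ non-crossing diagonals), and suppose the dual tree $T(G)$ is isomorphic to $T_{a,b}$ for some $a,b\ge 0$ with $a+b+2=n$. Then the number of collections of pairwise $G$-separated total orientations of $G$ that are maximal by inclusion (equivalently, maximal by size) equals $$2(n+1)\,\frac{n!}{(n-a)!}\,\frac{n!}{(n-b)!}.$$
   Context: The dual tree $T(G)$ has one vertex for each of the $n$ triangles of the triangulation, two vertices adjacent iff the triangles share a diagonal. For $a,b\ge 0$, $T_{a,b}$ is the tree on $a+b+2$ vertices consisting of the path $-a,-a+1,\dots,0,\dots,b$ together with one extra leaf $\ell$ attached to vertex $0$. Two total orientations $O_1,O_2$ of $G$ are $G$-separated if there is no cycle $C$ of $G$ that is directed in both $O_1$ and $O_2$ but in opposite directions. *)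

(* Defs.v *)
From mathcomp Require Import all_boot.
Set Implicit Arguments. Unset Strict Implicit. Unset Printing Implicit Defensive.

(* Convex (n+2)-gon with vertices 0, 1, ..., n+1 in cyclic order: 'I_n.+2. *)
Section Polygon.
Variable n : nat.
Notation V := 'I_n.+2.

Definition side (x y : V) : bool :=
  [|| (val y == (val x).+1), (val x == (val y).+1),
      (val x == 0) && (val y == n.+1) | (val y == 0) && (val x == n.+1)].

Definition is_diag (d : V * V) : bool := (d.1 < d.2) && ~~ side d.1 d.2.

Definition crossing (d e : V * V) : bool :=
  [|| [&& d.1 < e.1, e.1 < d.2 & d.2 < e.2] | [&& e.1 < d.1, d.1 < e.2 & e.2 < d.2]].

Definition triangulation (D : {set V * V}) : Prop :=
  [/\ forall d, d \in D -> is_diag d,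
      #|D| = n.-1 &
      forall d e, d \in D -> e \in D -> ~~ crossing d e].

Definition gedge (D : {set V * V}) (x y : V) : bool :=
  [|| side x y, (x, y) \in D | (y, x) \in D].

Definition triangle (D : {set V * V}) (t : {set V}) : bool :=
  (#|t| == 3) && [forall x in t, forall y in t, (x != y) ==> gedge D x y].

Definition dual_adj (D : {set V * V}) (t1 t2 : {set V}) : bool :=
  (t1 != t2) &&
  [exists d in D, [&& d.1 \in t1, d.2 \in t1, d.1 \in t2 & d.2 \in t2]].

Definition total_orientation (D : {set V * V}) (O : {set V * V}) : Prop :=
  (forall x y, (x, y) \in O -> gedge D x y) /\
  (forall x y, gedge D x y -> ((x, y) \in O) (+) ((y, x) \in O)).

Definition is_cycle (D : {set V * V}) (c : seq V) : Prop :=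
  [/\ uniq c, 3 <= size c & cycle (gedge D) c].

Definition directed_along (O : {set V * V}) (c : seq V) : Prop :=
  cycle (fun x y => (x, y) \in O) c.

Definition separated (D : {set V * V}) (O1 O2 : {set V * V}) : Prop :=
  ~ exists c : seq V,
      [/\ is_cycle D c, directed_along O1 c & directed_along O2 (rev c)].

Definition pairwise_separated (D : {set V * V}) (S : {set {set V * V}}) : Prop :=
  (forall O, O \in S -> total_orientation D O) /\
  (forall O1 O2, O1 \in S -> O2 \in S -> O1 != O2 -> separated D O1 O2).

Definition maximal_separated (D : {set V * V}) (S : {set {set V * V}}) : Prop :=
  pairwise_separated D S /\
  forall O, total_orientation D O -> O \notin S -> ~ pairwise_separated D (O |: S).

End Polygon.

(* The tree T_{a,b} on 'I_(a+b+2): index i <= a+b stands for path vertex i - a,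
   index a+b+1 stands for the extra leaf l, attached to path vertex 0 (index a). *)
Definition Tab_adj (a b : nat) (i j : 'I_(a + b + 2)) : bool :=
  [|| ((val i).+1 == val j) && (val j <= a + b),
      ((val j).+1 == val i) && (val i <= a + b),
      (val i == a) && (val j == a + b + 1)
    | (val j == a) && (val i == a + b + 1)].

Definition dual_iso_Tab (n : nat) (D : {set 'I_n.+2 * 'I_n.+2}) (a b : nat) : Prop :=
  exists f : 'I_(a + b + 2) -> {set 'I_n.+2},
    [/\ injective f,
        forall i, triangle D (f i),
        forall t, triangle D t -> exists i, f i = t &
        forall i j, Tab_adj i j = dual_adj D (f i) (f j)].

Definition num_maximal_collections (n : nat) (D : {set 'I_n.+2 * 'I_n.+2}) (k : nat) : Prop :=
  exists L : seq {set {set 'I_n.+2 * 'I_n.+2}},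
    [/\ uniq L, forall S, S \in L <-> maximal_separated D S & size L = k].

(* Main.v *)
Require Import Defs.
From mathcomp Require Import all_boot perm boolp.
From mathcomp Require Import zify ring.
Set Implicit Arguments. Unset Strict Implicit. Unset Printing Implicit Defensive.

(* A cycle of G bounds a subtree X of the dual tree T and an orientation directs
   it with a sign, so two orientations are separated iff no subtree receives
   opposite signs from them. Call a sign function on subtrees biclosed if, whenever
   an edge of T cuts X into two subtrees of the same sign, X has that sign too.

   Maximal separated collections correspond to biclosed sign functions. If S is
   separated, let P be the set of regions directed positively by some member of S.
   An orientation directing X directs one of the two halves of X, since it directs
   the diagonal cutting X; hence the closure of P under disjoint unions satisfies
   both biclosure conditions, and it contains no region that S directs negatively.
   Conversely, given a biclosed sign function, every subtree X with its sign is
   directed by a compatible orientation: direct each diagonal inside X according to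
   the sign of the branch it cuts off (X being rooted), and then add the remaining
   triangles one at a time, making each new vertex a sink.

   For T_{a,b} the subtrees avoiding the leaf are the pairs l < h of gaps of the
   path, and biclosed signs on them are total orders of the gaps. Together with the
   signs of the subtrees containing the leaf they amount to the sign of the leaf, an
   order of the a + 1 left gaps, an order of the b + 1 right gaps, and two nested
   lattice paths in a rectangle of size (a + 1) x (b + 1), which are counted by a
   2 x 2 determinant. *)

(** * Counting nested chains *)

Section NestedChains.
Variable p : nat.

(** A step of a chain: both heights weakly decrease and the new pair is nested. A chain of such
    steps encodes two nested lattice paths. *)
Definition below (z w : 'I_p.+1 * 'I_p.+1) : bool :=
  [&& w.1 <= z.1, w.2 <= z.2 & w.1 <= w.2].

Lemma below_trans : transitive below.
Proof. by move=> [? ?] [? ?] [? ?]; rewrite /below /=; lia. Qed.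

Definition num_chains q (z : 'I_p.+1 * 'I_p.+1) :=
  #|[set t : q.-tuple ('I_p.+1 * 'I_p.+1) | path below z t]|.

Lemma num_chains0 z : num_chains 0 z = 1.
Proof.
rewrite /num_chains -(cards1 [tuple of (@nil ('I_p.+1 * 'I_p.+1))]).
by apply: eq_card => t; rewrite !inE tuple0 /= eqxx.
Qed.

Lemma num_chainsS q z : num_chains q.+1 z = \sum_(w | below z w) num_chains q w.
Proof.
rewrite /num_chains.
under eq_bigr => w _ do rewrite -sum1_card.
rewrite (eq_bigr (fun w => \sum_(t : q.-tuple _ | path below w t) 1)); last first.
  by move=> w _; apply: eq_bigl => t; rewrite inE.
rewrite pair_big_dep /= -sum1_card.
rewrite (reindex (fun wt : ('I_p.+1 * 'I_p.+1) * q.-tuple ('I_p.+1 * 'I_p.+1) =>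
   [tuple of wt.1 :: wt.2])) /=.
  by apply: eq_bigl => -[w t]; rewrite inE.
exists (fun t => (thead t, [tuple of behead t])) => [[w t] _|t _] /=.
  by congr pair; apply: val_inj.
by rewrite [RHS]tuple_eta.
Qed.

Lemma sum_binD q x : \sum_(0 <= i < x) 'C(i + q, q) = 'C(x + q, q.+1).
Proof.
elim: x => [|x IH]; first by rewrite big_nil bin_small.
by rewrite big_nat_recr //= IH addSn binS addnC.
Qed.

Lemma sum_binDS q x : \sum_(0 <= i < x) 'C(i + q, q.+1) = 'C(x + q, q.+2).
Proof.
elim: x => [|x IH]; first by rewrite big_nil bin_small.
by rewrite big_nat_recr //= IH addSn binS addnC.
Qed.

Lemma sum_bin_shift q x :
  (\sum_(0 <= i < x) 'C(i + q, i.+1)).+1 = 'C(x + q, x).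
Proof.
elim: x => [|x IH]; first by rewrite big_nil bin0.
by rewrite big_nat_recr //= -addSn IH addSn binS addnC.
Qed.

Lemma binDC q x : 'C(x + q, x) = 'C(x + q, q).
Proof. by rewrite -(bin_sub (leq_addl x q)) addnK. Qed.

(** The 2 x 2 determinant for two nested paths, proved by induction on the first step, with the
    negative term moved to the left to avoid subtraction. The entry usually written
    [C(y + q, q - 1)] appears as [C(y + q, y + 1)], which vanishes at [q = 0] as it should. *)
Lemma num_chainsE q (z : 'I_p.+1 * 'I_p.+1) : z.1 <= z.2 ->
  num_chains q z + 'C(z.1 + q, q.+1) * 'C(z.2 + q, z.2.+1)
  = 'C(z.1 + q, q) * 'C(z.2 + q, q).
Proof.
elim: q z => [|q IH] [x y] /= lexy.
  by rewrite num_chains0 !bin0 [X in _ * X]bin_small ?muln0 //; lia.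
pose f i j := num_chains q (inord i, inord j).
have fE i j : i <= j <= p -> f i j + 'C(i + q, q.+1) * 'C(j + q, j.+1)
   = 'C(i + q, q) * 'C(j + q, q).
  move=> /andP[ij jp]; have := IH (inord i, inord j).
  by rewrite /= !inordK ?ltnS ?(leq_trans ij) //; apply.
have sumE (m M : nat) (g : nat -> nat) : M <= p ->
    \sum_(j < p.+1 | m <= j <= M) g j = \sum_(m <= j < M.+1) g j.
  move=> Mp; rewrite [RHS](big_nat_widen _ _ p.+1) ?ltnS //.
  rewrite [RHS](big_nat_widenl _ 0) // big_mkord.
  by apply: eq_bigl => j; rewrite !ltnS andbC.
have innerE i : i <= y ->
    \sum_(i <= j < y.+1) f i j + 'C(i + q, q.+1) * 'C(y.+1 + q, q)
    = 'C(i + q, q) * 'C(y.+1 + q, q.+1).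
  move=> iy.
  have: \sum_(i <= j < y.+1) f i j
      + 'C(i + q, q.+1) * \sum_(i <= j < y.+1) 'C(j + q, j.+1)
      = 'C(i + q, q) * \sum_(i <= j < y.+1) 'C(j + q, q).
    rewrite !big_distrr /= -big_split /=; apply: eq_big_nat => j Hj.
    by apply: fE; have := ltn_ord y; lia.
  have catE (g : nat -> nat) : \sum_(0 <= j < y.+1) g j =
      \sum_(0 <= j < i) g j + \sum_(i <= j < y.+1) g j.
    by rewrite -big_cat_nat // leqW.
  (* Each sum over [j] is a difference of two closed forms; the subtracted parts give the same
     product [C(i + q, q) C(i + q, q + 1)] on both sides and cancel. *)
  have := catE (fun j => 'C(j + q, q)); rewrite !sum_binD => ->.
  have := sum_bin_shift q y.+1; rewrite catE -addSn sum_bin_shift !binDC => <-.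
  by rewrite !mulnDr addnCA => ->; rewrite mulnC.
have -> : num_chains q.+1 (x, y) = \sum_(0 <= i < x.+1) \sum_(i <= j < y.+1) f i j.
  transitivity (\sum_(i < p.+1 | 0 <= i <= x) \sum_(j < p.+1 | i <= j <= y) f i j).
    rewrite num_chainsS pair_big_dep /=; apply: eq_big => [[i j]|[i j] _].
      by rewrite /below /= [X in _ && X]andbC.
    by rewrite /f !inord_val.
  rewrite -(sumE 0 x (fun i => \sum_(i <= j < y.+1) f i j)) -1?ltnS //.
  by apply: eq_bigr => i _; apply: (sumE i y (f i)); rewrite -ltnS.
have : \sum_(0 <= i < x.+1) \sum_(i <= j < y.+1) f i j
    + (\sum_(0 <= i < x.+1) 'C(i + q, q.+1)) * 'C(y.+1 + q, q)
    = (\sum_(0 <= i < x.+1) 'C(i + q, q)) * 'C(y.+1 + q, q.+1).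
  rewrite !big_distrl /= -big_split /=; apply: eq_big_nat => i Hi.
  by apply: innerE; lia.
rewrite sum_binD sum_binDS !addnS !addSn => <-; congr (_ + _ * _).
by rewrite -addSn binDC.
Qed.

(** The Narayana number [(p + q)! (p + q + 1)! / (p! q! (p + 1)! (q + 1)!)], with its denominator
    cleared. *)
Lemma num_chains_top q :
  num_chains q (ord_max, ord_max) * (p`! * q`!) * (p.+1`! * q.+1`!)
  = (p + q)`! * (p + q).+1`!.
Proof.
have := @num_chainsE q (ord_max, ord_max) (leqnn _); rewrite /=.
have := mul_bin_left (p + q) q; have := mul_bin_left (p + q) p.
rewrite addnK addKn binDC !factS -(bin_fact (leq_addl p q)) addnK.
set c := 'C(p + q, q); set c1 := 'C(_, q.+1); set c2 := 'C(_, p.+1).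
set u := num_chains _ _; move=> E2 E1 E.
(* After multiplication by [(p + 1)(q + 1)] the determinant becomes [c^2 ((p + 1)(q + 1) - p q)],
   and the last factor is [p + q + 1]. *)
have {E E1 E2} : u * p.+1 * q.+1 = (p + q).+1 * c * c.
  apply: (@addIn ((q.+1 * c1) * (p.+1 * c2))); rewrite [in RHS]E1 [in RHS]E2.
  by transitivity ((u + c1 * c2) * p.+1 * q.+1); [ring|rewrite E; ring].
move=> E; transitivity (u * p.+1 * q.+1 * (p`! * q`!) * (p`! * q`!)); first by ring.
by rewrite E; ring.
Qed.
End NestedChains.

Section ChainHeights.
Variables p q : nat.

(** [below] is transitive, so a path is pairwise decreasing, and a start at the maximal pair imposes
    no bound on the heights. *)
Lemma chain_heightsP (t : q.-tuple ('I_p.+1 * 'I_p.+1)) : reflect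
  ((forall y, (tnth t y).1 <= (tnth t y).2) /\
   forall y y' : 'I_q, y < y' ->
     (tnth t y').1 <= (tnth t y).1 /\ (tnth t y').2 <= (tnth t y).2)
  (path (@below p) (ord_max, ord_max) t).
Proof.
have x0 : 'I_p.+1 * 'I_p.+1 := (ord0, ord0).
rewrite path_sortedE; last exact: below_trans.
rewrite (sorted_pairwise (@below_trans p)).
apply: (iffP andP) => [[/all_tnthP bt /(pairwiseP x0) st]|[le1 le2]].
  split=> [y|y y' yy']; first by have /and3P[] := bt y.
  have := st y y'; rewrite !inE size_tuple !ltn_ord -!(tnth_nth x0).
  by case/(_ isT isT yy')/and3P.
split; first by apply/all_tnthP => y; rewrite /below /= le1 !leq_ord.
apply/(pairwiseP x0) => i j; rewrite !inE size_tuple => iq jq ij.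
have [] := le2 (Ordinal iq) (Ordinal jq) ij; rewrite /below.
by rewrite !(tnth_nth x0) /= => -> ->; have := le1 (Ordinal jq); rewrite (tnth_nth x0).
Qed.
End ChainHeights.

(** * Permutations as linear orders *)

Section Ranks.
Variables (k : nat) (lt : rel 'I_k).

Lemma perm_of_order : irreflexive lt -> transitive lt ->
  (forall i j, i != j -> lt i j || lt j i) ->
  exists g : 'S_k, forall i j, (g i < g j) = lt i j.
Proof.
move=> irr tr tot.
have rk_lt i : #|[pred j | lt j i]| < k.
  rewrite -[X in _ < X](card_ord k); apply: proper_card.
  by apply/properP; split; [apply/subsetP|exists i; rewrite // !inE irr].
pose rk i := Ordinal (rk_lt i).
have rkP i j : lt i j -> rk i < rk j.
  move=> ij; apply: proper_card; apply/properP; split.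
    by apply/subsetP => l; rewrite !inE => li; apply: tr ij.
  by exists i; rewrite !inE ?irr.
have rk_inj : injective rk.
  move=> i j e; apply/eqP; apply: contraT => /tot/orP[] /rkP; by rewrite e ltnn.
exists (perm rk_inj) => i j; rewrite !permE.
apply/idP/idP => [ij|]; last exact: rkP.
have /tot/orP[//|/rkP] : i != j by apply: contraTneq ij => ->; rewrite ltnn.
by lia.
Qed.
End Ranks.

Lemma card_ord_below k m : m <= k -> #|[pred j : 'I_k | j < m]| = m.
Proof.
move=> mk; have inj : injective (widen_ord mk) by move=> i j [] /val_inj.
rewrite -[RHS]card_ord -(card_image inj).
apply: eq_card => j; rewrite !inE; apply/idP/imageP => [jm|[i _ ->]]; last exact: (ltn_ord i).
by exists (Ordinal jm); last exact: val_inj.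
Qed.

Lemma perm_ltn_flip k (f : 'S_k) i j : i != j -> (f i < f j) = ~~ (f j < f i).
Proof. by move=> ij; rewrite -leqNgt ltn_neqAle (inj_eq val_inj) (inj_eq perm_inj) ij. Qed.

Lemma ltn_all_eq k (c c' : 'I_k.+1) : (forall x : 'I_k, (x < c) = (x < c')) -> c = c'.
Proof.
move=> cc'; apply: ord_inj; have [lt|lt|//] := ltngtP c c'.
  have ck : c < k by have := ltn_ord c'; lia.
  by have := cc' (Ordinal ck); rewrite /= ltnn lt.
have ck : c' < k by have := ltn_ord c; lia.
by have := cc' (Ordinal ck); rewrite /= ltnn lt.
Qed.

(** The value [g i] is the number of [j] with [g j < g i], so the order determines [g]. Pairs
    [i < j] suffice, the other comparisons being negations of these. *)
Lemma perm_order_inj k (g h : 'S_k) :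
  (forall i j : 'I_k, i < j -> (g i < g j) = (h i < h j)) -> g = h.
Proof.
move=> gh.
have {}gh i j : (g i < g j) = (h i < h j).
  have [ij|ji|/val_inj ->] := ltngtP i j; [exact: gh| |by rewrite !ltnn].
  have ij : i != j by rewrite -val_eqE gtn_eqF.
  by rewrite (perm_ltn_flip g) // (perm_ltn_flip h) // gh.
have rkE (f : 'S_k) i : #|[pred j | f j < f i]| = f i.
  rewrite -[RHS](card_ord_below (ltnW (ltn_ord (f i)))).
  rewrite (card_preim (@perm_inj _ f) [pred j : 'I_k | j < f i]).
  by apply: eq_card => j; rewrite !inE -[j](permKV f) codom_f.
apply/permP => i; apply: val_inj; rewrite -[LHS]rkE -[RHS]rkE.
by apply: eq_card => j; rewrite !inE gh.
Qed.

Lemma downset_card k (P : pred 'I_k) : (forall i j : 'I_k, i <= j -> P j -> P i) ->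
  forall i, P i = (i < #|P|).
Proof.
move=> down i; apply/idP/idP => Pi.
  rewrite -(card_ord_below (ltn_ord i)); apply: subset_leq_card.
  by apply/subsetP => j; rewrite !inE ltnS => /down; apply.
apply: contraLR Pi => nPi; rewrite -leqNgt.
rewrite -[X in _ <= X](card_ord_below (ltnW (ltn_ord i))); apply: subset_leq_card.
apply/subsetP => j; rewrite !inE ltnNge => Pj.
by apply: contra nPi => /down; apply.
Qed.

(** With [s x y] read as [x] preceding [y], the hypothesis excludes exactly the two cyclic patterns
    on each triple, and a tournament without cyclic triples is a linear order. *)
Lemma perm_of_triples k (s : rel 'I_k) :
  (forall x y z : 'I_k, x < y -> y < z -> s x y = s y z -> s x z = s x y) ->
  exists g : 'S_k, forall i j : 'I_k, i < j -> (g i < g j) = s i j.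
Proof.
move=> T; pose lt (i j : 'I_k) := if i < j then s i j else (j < i) && ~~ s j i.
have [|y x z|x y|g gE] := @perm_of_order _ lt.
- by move=> x; rewrite /lt ltnn.
- rewrite /lt; case: (ltngtP x y) => [xy|xy|/ord_inj ->] //;
    case: (ltngtP y z) => [yz|yz|/ord_inj <-] //=.
  + by rewrite (ltn_trans xy yz); have := T x y z xy yz; do 2!case: (s _ _) => //; move=> ->.
  + case: (ltngtP x z) => [xz|xz|/ord_inj <-] /=; last by case: (s _ _).
      by have := T x z y xz yz; do 3!case: (s _ _) => //; move=> /(_ erefl).
    by have := T z x y xz xy; do 3!case: (s _ _) => //; move=> /(_ erefl).
  + case: (ltngtP x z) => [xz|xz|/ord_inj <-] /=; last by case: (s _ _).
      by have := T y x z xy xz; do 3!case: (s _ _) => //; move=> /(_ erefl).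
    by have := T y z x yz xz; do 3!case: (s _ _) => //; move=> /(_ erefl).
  + have zx := ltn_trans yz xy; rewrite [x < z]ltnNge (ltnW zx) zx /=.
    by have := T z y x yz xy; do 3!case: (s _ _) => //; move=> /(_ erefl).
- by rewrite /lt -(inj_eq val_inj) /=; case: ltngtP => //; case: (s _ _).
by exists g => i j ij; rewrite gE /lt ij.
Qed.

(** * Regions of a rooted triangulation *)


(* [bd i] is the set of counterclockwise arcs of the [i]-th triangle and [p] the
   parent map of the dual tree; the triangles are numbered so that each one is
   glued to its parent along one edge and brings one new vertex. *)
Record rooted_triangulation n (D : {set 'I_n.+2 * 'I_n.+2}) N
    (bd : 'I_N -> rel 'I_n.+2) (p : 'I_N -> 'I_N) : Prop := RootedTriangulation {
  bd_uniq : forall i j x y, bd i x y -> bd j x y -> i = j;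
  bd_gedge : forall x y, gedge D x y = [exists i, bd i x y || bd i y x];
  bd_triangle : forall i, exists x y z, uniq [:: x; y; z] /\
    forall u w, bd i u w = ((u, w) \in [:: (x, y); (y, z); (z, x)]);
  parent_lt : forall i : 'I_N, 0 < i -> p i < i;
  parent_adj : forall (i j : 'I_N) x y, bd i x y -> bd j y x -> i < j -> i = p j;
  parent_edge : forall i : 'I_N, p i < i -> exists x y, bd i x y /\ bd (p i) y x;
  new_vertex : forall i : 'I_N, exists2 v, exists y, bd i v y &
    forall j : 'I_N, j < i -> forall y, ~~ bd j v y;
  outer_edge : forall r : 'I_N, exists x y, bd r x y /\ forall j, bd j y x -> j < r
}.

(** A walk that can always be continued must revisit a vertex; the stretch between the first such
    pair of visits is a simple cycle. *)
Lemma exists_uniq_cycle (T : finType) (e : rel T) x y : e x y ->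
  (forall x y, e x y -> exists z, e y z) ->
  exists c, [/\ uniq c, c != [::] & cycle e c].
Proof.
move=> exy next.
suff grow m s : #|T| < size s + m -> uniq (y :: s) -> path e y s ->
    (exists z, e (last y s) z) -> exists c, [/\ uniq c, c != [::] & cycle e c].
  by apply: (grow #|T|.+1 [::]); rewrite ?addnS ?add0n //=; exact: next exy.
elim: m s => [|m IH] s.
  rewrite addn0 => sT us _ _; have := max_card (mem (y :: s)).
  by rewrite (card_uniqP us) /= leqNgt ltnW // ltnS ltnW.
move=> sm us ps [z lz]; have [zs|zs] := boolP (z \in y :: s); last first.
  apply: (IH (rcons s z)); rewrite ?size_rcons ?last_rcons; first by lia.
  - by rewrite -rcons_cons rcons_uniq zs.
  - by rewrite rcons_path ps.
  exact: next lz.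
have {ps} : sorted e (y :: s) by [].
have {lz} : e (last z (y :: s)) z by [].
move: us; case/splitPr: zs => s1 s2; rewrite cat_uniq last_cat /= => /and3P[_ _ us] lz ss.
exists (z :: s2); split=> //; rewrite /= rcons_path lz andbT.
by case: s1 ss => [//|t s1]; rewrite /= cat_path /= => /and3P[].
Qed.

Lemma gedge_sym n (D : {set 'I_n.+2 * 'I_n.+2}) : symmetric (gedge D).
Proof.
move=> x y; rewrite /gedge [((x, y) \in D) || _]orbC; congr (_ || _).
by rewrite /side orbCA; congr [|| _, _ | _]; rewrite orbC.
Qed.

Section Regions.
Variables (n N : nat) (D : {set 'I_n.+2 * 'I_n.+2}).
Variables (bd : 'I_N -> rel 'I_n.+2) (p : 'I_N -> 'I_N).
Hypothesis disk : rooted_triangulation D bd p.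
Notation V := 'I_n.+2.
Notation orientation := {set 'I_n.+2 * 'I_n.+2}.
Implicit Types (i j k r : 'I_N) (x y z u v w : V) (s : bool) (X Y Z : {set 'I_N}) (O : orientation).

Definition arc s i x y := if s then bd i x y else bd i y x.

(* The orientation [s = true] (resp. [false]) runs counterclockwise (resp.
   clockwise) around the region [X]; [X] need not be connected. *)
Definition boundary s X x y :=
  [exists i in X, arc s i x y] && ~~ [exists i in X, arc s i y x].

(** Connectedness in the dual tree, expressed by the top triangle [r]: every other member has its
    parent in [X]. The test [p i < i] certifies that [i] has a parent, as the value of [p] at the
    root carries no meaning. *)
Definition subtree X :=
  [exists r in X, [forall i in X, (i != r) ==> (p i < i) && (p i \in X)]].

Lemma arcN s i x y : arc (~~ s) i x y = arc s i y x.
Proof. by case: s. Qed.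

Lemma boundaryN s X x y : boundary (~~ s) X x y = boundary s X y x.
Proof. by rewrite /boundary; case: s. Qed.

Lemma arc_uniq s i j x y : arc s i x y -> arc s j x y -> i = j.
Proof. by case: s; exact: (bd_uniq disk). Qed.

Lemma arc_rot s i x y : arc s i x y -> exists z, uniq [:: x; y; z] /\
  forall u w, arc s i u w = ((u, w) \in [:: (x, y); (y, z); (z, x)]).
Proof.
have [a [b [c [abc E]]]] := bd_triangle disk i.
have [/negPf ab /negPf ac /negPf bc] : [/\ a != b, a != c & b != c].
  by move: abc; rewrite /= !inE negb_or; case/and3P => /andP[].
have [ba ca cb] : [/\ (b == a) = false, (c == a) = false & (c == b) = false].
  by rewrite ![_ == a]eq_sym [c == b]eq_sym.
case: s; rewrite /= E !inE; case/or3P => /eqP[-> ->]; [exists c|exists a|exists b|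
  exists c|exists a|exists b]; rewrite /= !inE ?(ab, ac, bc, ba, ca, cb);
  by split=> // u w; rewrite E !inE !xpair_eqE; do !case: (_ == _).
Qed.

Lemma arc_asym s i x y : arc s i x y -> ~~ arc s i y x.
Proof.
move=> xy; have [z [xyz ->]] := arc_rot xy; move: xyz.
by rewrite /= !inE !xpair_eqE; do ?case: eqP => //; congruence.
Qed.

Lemma arc_neq s i x y : arc s i x y -> x != y.
Proof. by apply: contraTneq => ->; apply/negP => h; have := arc_asym h; rewrite h. Qed.

Lemma gedge_arc s i x y : arc s i x y -> gedge D x y.
Proof.
by case: s => /= xy; rewrite (bd_gedge disk); apply/existsP; exists i; rewrite xy ?orbT.
Qed.

Lemma arc_gedge s x y : gedge D x y -> exists i, arc s i x y || arc s i y x.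
Proof.
by rewrite (bd_gedge disk) => /existsP[i xy]; exists i; case: s xy; rewrite // orbC.
Qed.

Lemma gedge_neq x y : gedge D x y -> x != y.
Proof. by case/(arc_gedge true) => i /orP[] /arc_neq //; rewrite eq_sym. Qed.

Lemma arc_parent s i j x y : arc s i x y -> arc s j y x -> i < j -> i = p j.
Proof. by case: s => xy yx; [exact: (parent_adj disk xy yx)|exact: (parent_adj disk xy yx)]. Qed.

Lemma arc_parent_edge s i : p i < i -> exists x y, arc s i x y /\ arc s (p i) y x.
Proof.
by case: s => /(parent_edge disk) [x [y [xy yx]]]; [exists x, y|exists y, x].
Qed.

Definition vertex_of i x := [exists y, bd i x y].

Lemma arc_vtl s i x y : arc s i x y -> vertex_of i x.
Proof.
move=> xy; have [z [_ E]] := arc_rot xy.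
case: s xy E => xy E; apply/existsP; first by exists y.
by exists z; have := E z x; rewrite /= !inE eqxx !orbT.
Qed.

Lemma arc_vtr s i x y : arc s i x y -> vertex_of i y.
Proof. by rewrite -[s]negbK arcN => /arc_vtl. Qed.

Lemma vt_arc s i x y z : arc s i x y -> arc s i y z ->
  forall v, vertex_of i v -> v \in [:: x; y; z].
Proof.
move=> xy yz v /existsP[w vw]; have [z' [xyz E]] := arc_rot xy.
have {yz} : z = z'.
  by move: yz xyz; rewrite E /= !inE !xpair_eqE; do ?case: eqP => //; congruence.
move=> ->; have : arc s i v w || arc s i w v by case: (s); rewrite /= vw ?orbT.
by rewrite !E !inE !xpair_eqE; do ?case: (_ =P _) => //=.
Qed.

Lemma arcE s i x y v : arc s i x y -> vertex_of i v -> v != x -> v != y ->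
  forall u w, arc s i u w = ((u, w) \in [:: (x, y); (y, v); (v, x)]).
Proof.
move=> xy iv vx vy; have [z [xyz E]] := arc_rot xy.
suff -> : v = z by [].
have yz : arc s i y z by rewrite E !inE eqxx orbT.
by have := vt_arc xy yz iv; rewrite !inE (negPf vx) (negPf vy) => /eqP.
Qed.

Lemma new_vt i : exists2 v, vertex_of i v & forall j, j < i -> ~~ vertex_of j v.
Proof.
have [v [y vy] nv] := new_vertex disk i; exists v; first by apply/existsP; exists y.
by move=> j /nv vj; apply/existsPn.
Qed.

(** The vertex brought by [i] does not belong to [p i], and only one arc of [i] avoids that
    vertex. *)
Lemma arc_shared_uniq s i x y x' y' : p i < i ->
  arc s i x y -> arc s (p i) y x -> arc s i x' y' -> arc s (p i) y' x' ->
  x = x' /\ y = y'.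
Proof.
move=> pi xy yx xy' yx'; have [v iv /(_ _ pi) nv] := new_vt i.
have ne w : vertex_of (p i) w -> v != w by apply: contraTneq => <-.
have E := arcE xy iv (ne _ (arc_vtr yx)) (ne _ (arc_vtl yx)).
have := ne _ (arc_vtr yx'); have := ne _ (arc_vtl yx').
move: xy'; rewrite E !inE => /or3P[] /eqP[-> ->] //; by rewrite eqxx.
Qed.

(** * Cycles as boundaries of subtrees *)

Definition early_vertex (k : nat) x := [exists i : 'I_N, (i < k) && vertex_of i x].

(** A triangle numbered at least [k] brings a vertex that is not an endpoint, so the edge is the one
    shared with the parent, and the search moves on to the parent. *)
Lemma gedge_early (k : nat) x y : gedge D x y -> early_vertex k x -> early_vertex k y ->
  exists2 i : 'I_N, i < k & bd i x y || bd i y x.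
Proof.
move=> xy /existsP[jx /andP[jxk vjx]] /existsP[jy /andP[jyk vjy]].
have [i] := arc_gedge true xy; have [m] := ubnP (val i); elim: m i => // m IH i /= im exy.
have [ik|ki] := ltnP i k; first by exists i.
have pi : p i < i by apply: (parent_lt disk); apply: leq_trans ki; apply: leq_trans jxk.
have [v iv nv] := new_vt i.
have [u [w [uw wu]]] := arc_parent_edge true pi.
have ne t : vertex_of (p i) t -> v != t by apply: contraTneq => <-; exact: nv.
have vx : v != x by apply: contraTneq vjx => <-; apply/nv/(leq_trans jxk).
have vy : v != y by apply: contraTneq vjy => <-; apply/nv/(leq_trans jyk).
apply: (IH (p i)); first exact: (leq_trans pi im).
have E := arcE uw iv (ne _ (arc_vtr wu)) (ne _ (arc_vtl wu)).
move: exy; rewrite /= in E wu *; rewrite !E !inE !xpair_eqE.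
rewrite ![_ == v]eq_sym (negPf vx) (negPf vy) !andbF /= !orbF.
by case/orP => /andP[/eqP -> /eqP ->]; rewrite wu ?orbT.
Qed.

Lemma boundary_arc s X x y : boundary s X x y ->
  exists2 i, i \in X & arc s i x y /\ forall j, j \in X -> ~~ arc s j y x.
Proof.
case/andP => /existsP[i /andP[iX ixy]] /existsPn nX; exists i => //; split=> // j jX.
by have := nX j; rewrite jX.
Qed.

Lemma arc_boundary s X i x y : i \in X -> arc s i x y ->
  (forall j, j \in X -> ~~ arc s j y x) -> boundary s X x y.
Proof.
move=> iX ixy nX; apply/andP; split; first by apply/existsP; exists i; rewrite iX.
by apply/existsPn => j; apply/negP => /andP[/nX/negP].
Qed.

Lemma subtreeP X : reflect
  (exists2 r, r \in X & forall i, i \in X -> i != r -> p i < i /\ p i \in X) (subtree X).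
Proof.
apply: (iffP existsP) => [[r /andP[rX /forallP H]]|[r rX H]]; exists r => //.
  by move=> i iX ir; have := H i; rewrite iX ir => /andP.
rewrite rX; apply/forallP => i; apply/implyP => iX; apply/implyP => ir.
by apply/andP; apply: H.
Qed.

Lemma arc_out_uniq s i x y z : arc s i x y -> arc s i x z -> y = z.
Proof.
move=> xy; have [w [xyw E]] := arc_rot xy; move: xyw; rewrite E /= !inE !xpair_eqE.
by do ?case: (_ =P _) => //=; congruence.
Qed.

(** A simple path never leaves its last vertex, so arcs out of that vertex may be dropped from the
    relation. *)
Lemma path_uniq_last (e e' : rel V) x (s : seq V) :
  uniq (x :: s) -> (forall u w, e' u w -> u != last x s -> e u w) ->
  path e' x s -> path e x s.
Proof.
move=> + ee'; elim/last_ind: s ee' => // s z _.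
rewrite last_rcons -rcons_cons rcons_uniq => ee' /andP[zs _].
rewrite !rcons_path => /andP[xs zl]; apply/andP; split.
  apply: (@sub_in_path _ (predC1 z) e' e) xs.
    by move=> u w uz _ /ee'; apply.
  by apply/allP => u us; apply: contraNneq zs => <-.
by apply: ee' => //; apply: contraNneq zs => <-; exact: mem_last.
Qed.

(* Induction on the number of triangles: a cycle through the vertex brought by
   the last triangle [K] is [K] itself or is shortened by removing that vertex. *)
Lemma cycle_region (k : nat) (c : seq V) : k <= N ->
  uniq c -> 2 < size c -> cycle (gedge D) c -> all (early_vertex k) c ->
  exists s X, [/\ subtree X, forall i, i \in X -> i < k &
    forall e : rel V, cycle e c <-> (forall x y, boundary s X x y -> e x y)].
Proof.
elim: k c => [|k IH] c kN uc sc cc vc.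
  by case: c sc vc {uc cc} => // v c _ /= /andP[/existsP[i]].
have [ac|] := boolP (all (early_vertex k) c).
  have [s [X [tX Xk E]]] := IH c (ltnW kN) uc sc cc ac.
  by exists s, X; split=> // i /Xk; exact: leqW.
case/allPn => v vinc nkv; have [i0 c' cE] := rot_to vinc.
have {IH} : exists s X, [/\ subtree X, forall i, i \in X -> i < k.+1 &
    forall e : rel V, cycle e (v :: c') <-> (forall x y, boundary s X x y -> e x y)]; last first.
  case=> s [X [tX Xk E]]; exists s, X; split=> // e.
  by rewrite -E -cE rot_cycle.
have {uc} uc : uniq (v :: c') by rewrite -cE rot_uniq.
have {sc} sc : 2 < size (v :: c') by rewrite -cE size_rot.
have {cc} cc : cycle (gedge D) (v :: c') by rewrite -cE rot_cycle.
have {vc vinc c cE i0} vc : all (early_vertex k.+1) (v :: c').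
  by rewrite -cE; apply/allP => x; rewrite mem_rot; move/allP: vc; apply.
pose K := Ordinal kN : 'I_N.
have vkS x : early_vertex k.+1 x -> early_vertex k x \/ vertex_of K x.
  case/existsP => i /andP[]; rewrite ltnS leq_eqVlt => /orP[/eqP ik|ik] vi.
    by right; rewrite (_ : K = i) //; apply: val_inj.
  by left; apply/existsP; exists i; rewrite ik.
have vkI i x : i < k -> vertex_of i x -> early_vertex k x by move=> ik ix; apply/existsP; exists i; rewrite ik.
have vonly i : i < k.+1 -> vertex_of i v -> i = K.
  rewrite ltnS leq_eqVlt => /orP[/eqP ik _|ik /(vkI _ _ ik)]; first exact: val_inj.
  by rewrite (negPf nkv).
have gv x : x \in c' -> gedge D v x -> bd K v x || bd K x v.
  move=> xc vx; have /andP[kv /allP kc] := vc.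
  have [i ik ivx] := gedge_early vx kv (kc _ xc).
  rewrite -(vonly i ik) //.
  by case/orP: ivx => [/(@arc_vtl true)|/(@arc_vtr true)].
case: c' uc sc cc vc gv => // w s' uc sc cc vc gv.
have us : uniq (w :: s') by case/andP: uc.
have cE (e : rel V) : cycle e (v :: w :: s') = [&& e v w, path e w s' & e (last w s') v].
  by rewrite /= rcons_path.
set u := last w s' in cE; have uin : u \in w :: s' by exact: mem_last.
have wu : w != u.
  rewrite /u; case: (s') us sc => // x s2 /andP[ws _] _ /=; apply: contraNneq ws => {1}->.
  exact: mem_last.
move: (cc); rewrite cE => /and3P[gvw ps guv].
have vw : v != w by apply: gedge_neq gvw.
have uv : u != v by apply: gedge_neq guv.
(* [K] is the only triangle considered so far that contains [v], so both edges of the cycle at [v]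
   are edges of [K]; as [w] and [u] differ, one leaves and the other enters [v] with a common sign
   [s]. *)
have [s /andP[svw suv]] : exists s, arc s K v w && arc s K u v.
  have := gv u uin; rewrite gedge_sym => /(_ guv).
  have := gv w (mem_head _ _) gvw.
  case/orP => h1 /orP[] h2.
  - by have := @arc_out_uniq true _ _ _ _ h1 h2; move/eqP: wu.
  - by exists true; rewrite /= h1.
  - by exists false; rewrite /= h1.
  by have := @arc_out_uniq false _ _ _ _ h1 h2; move/eqP: wu.
have Ku : vertex_of K u by apply: arc_vtl suv.
have E : forall x y, arc s K x y = ((x, y) \in [:: (v, w); (w, u); (u, v)]).
  by apply: arcE => //; rewrite eq_sym.
have swu : arc s K w u by rewrite E !inE eqxx orbT.
have avX i x y : i < k -> arc s i x y -> (x != v) && (y != v).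
  move=> ik xy; apply/andP; split; apply: contraNneq nkv => <-; apply: (vkI i) => //.
    exact: arc_vtl xy.
  exact: arc_vtr xy.
(* When [w] is followed directly by [u], the cycle runs around [K] alone. *)
have [s'u|s2] := eqVneq (size s') 1.
  case: s' @u us uc sc cc vc gv uin wu gvw ps guv uv suv Ku swu E avX s'u cE => // u' [] //=.
  move=> us uc _ _ _ _ _ wu _ _ _ uv suv Ku swu E avX _ cE; exists s, [set K]; split.
  - by apply/subtreeP; exists K => [|i]; rewrite !inE // => /eqP ->; rewrite eqxx.
  - by move=> i; rewrite inE => /eqP ->.
  move=> e; rewrite cE; split=> [/and3P[e1 /andP[e2 _] e3] x y|H].
    by case/boundary_arc => i; rewrite inE => /eqP -> [+ _]; rewrite E !inE => /or3P[] /eqP[-> ->].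
  have D1 x y : arc s K x y -> e x y.
    move=> xy; apply: H; apply: (arc_boundary (i := K)); rewrite ?inE //.
    by move=> j; rewrite inE => /eqP ->; exact: arc_asym xy.
  by rewrite !D1.
have {s2} s2 : 1 < size s' by case: (s') s2 sc => [|? []].
have k0 : 0 < k.
  rewrite lt0n; apply/eqP => k0.
  have : size (w :: s') <= size [:: w; u].
    apply: uniq_leq_size => // x xs.
    have /(allP vc)/vkS[/existsP[i]|] : x \in v :: w :: s' by rewrite inE xs orbT.
      by rewrite k0.
    move/(vt_arc svw swu); rewrite !inE => /orP[/eqP xv|//].
    by case/andP: uc; rewrite -xv xs.
  by rewrite /= ltnS leqNgt s2.
have pK : p K < K by apply: (parent_lt disk).
have vkwu : early_vertex k w /\ early_vertex k u.
  have [x [y [xy yx]]] := arc_parent_edge s pK.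
  move: (xy); rewrite E !inE; have /andP[yv xv] := avX _ _ _ pK yx.
  have /vkI /(_ (arc_vtl yx)) ky := pK; have /vkI /(_ (arc_vtr yx)) kx := pK.
  by case/or3P=> /eqP[xE yE]; move: xv yv kx ky; rewrite xE yE ?eqxx.
have vks : all (early_vertex k) (w :: s').
  apply/allP => x xs.
  have /(allP vc)/vkS[//|] : x \in v :: w :: s' by rewrite inE xs orbT.
  move/(vt_arc svw swu); rewrite !inE => /or3P[] /eqP xE; rewrite xE; try by case: vkwu.
  by case/andP: uc; rewrite -xE xs.
have cs : cycle (gedge D) (w :: s').
  by rewrite /= rcons_path ps -/u gedge_sym (gedge_arc swu).
(* Without [v] the cycle closes through the chord from [u] to [w], whose arc belongs to a triangle
   [i] of the smaller region. *)
have [s1 [X [tX Xk Ecs]]] := IH _ (ltnW kN) us s2 cs vks.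
have cycE (e : rel V) : cycle e (w :: s') = path e w s' && e u w by rewrite /= rcons_path.
have Xuw : boundary s1 X u w.
  by have : cycle (boundary s1 X) (w :: s') by [apply/Ecs]; rewrite cycE => /andP[].
have [i iX [iuw nX]] := boundary_arc Xuw.
have iK : i < K by exact: Xk.
(* With opposite signs, [i] and [K] would lie on the same side of the chord and hence coincide. *)
have ? : s1 = s.
  apply/eqP; apply: contraTT iK => /eqP ss1; rewrite (_ : i = K) ?ltnn //.
  by apply: (arc_uniq iuw); have -> : s1 = ~~ s; [case: (s) (s1) ss1 => [] []|rewrite arcN].
subst s1.
have iE : i = p K by apply: arc_parent iuw swu iK.
have XK : K \notin X by apply/negP => /Xk; rewrite ltnn.
exists s, (K |: X); split.
- case/subtreeP: tX => r rX H; apply/subtreeP; exists r; first by rewrite !inE rX orbT.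
  move=> j; rewrite !inE => /orP[/eqP -> _|/H jX /jX[? ->]]; last by rewrite orbT.
  by rewrite -iE iX orbT.
- by move=> j; rewrite !inE => /orP[/eqP ->//|/Xk /ltnW].
move=> e; rewrite cE; split.
  case/and3P => e1 e2 e3 x y /boundary_arc[j]; rewrite !inE => /orP[/eqP -> [+ nKX]|jX [jxy nKX]].
    rewrite E !inE => /or3P[] /eqP[xE yE]; rewrite xE yE //.
    by have := nKX i; rewrite xE yE !inE iX orbT iuw => /(_ isT).
  (* The shorter cycle uses the chord, which [e] need not contain; the induction hypothesis holds
     for every relation and is applied to [e] enlarged by the chord. *)
  pose e' x y := e x y || ((x, y) == (u, w)).
  have : e' x y.
    have : cycle e' (w :: s').
      rewrite cycE /e' eqxx orbT andbT; apply: sub_path e2 => ? ? ->; by [].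
    move/Ecs; apply; apply: (arc_boundary jX) => // l lX; apply: nKX; by rewrite !inE lX orbT.
  case/orP => // /eqP[xE yE]; have := nKX K; rewrite !inE eqxx xE yE swu => /(_ isT) //.
move=> H.
have Hv x y : (x == v) || (y == v) -> arc s K x y -> e x y.
  move=> xyv Kxy; apply: H; apply: (arc_boundary (i := K)); rewrite ?inE ?eqxx //.
  move=> j; rewrite !inE => /orP[/eqP ->|/Xk jk]; first exact: arc_asym Kxy.
  apply/negP => /(avX _ _ _ jk); by case/orP: xyv => ->; rewrite ?andbF.
rewrite !Hv ?eqxx ?orbT //= andbT.
pose e' x y := e x y || ((x, y) == (u, w)).
apply: (@path_uniq_last e e') => //.
  by move=> x y /orP[//|/eqP[-> _]]; rewrite eqxx.
have /Ecs : forall x y, boundary s X x y -> e' x y; last by rewrite cycE => /andP[].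
move=> x y /boundary_arc[j jX [jxy nXyx]].
have [xy|ne] := boolP ((x, y) == (u, w)); first by rewrite /e' xy orbT.
apply/orP; left; apply: H; apply: (arc_boundary (i := j)) => //; first by rewrite !inE jX orbT.
move=> l; rewrite !inE => /orP[/eqP ->|/nXyx //].
rewrite E !inE; have /andP[xv yv] := avX _ _ _ (Xk _ jX) jxy.
by rewrite !xpair_eqE (negPf xv) (negPf yv) andbF /= orbF andbC -xpair_eqE.
Qed.

(* Every triangle enters and leaves each of its vertices once, and cancelling
   pairs of opposite arcs preserves this balance. *)
Lemma boundary_balanced s X x y : boundary s X x y -> exists z, boundary s X y z.
Proof.
pose A u w := [exists i in X, arc s i u w].
have sumA u w : \sum_(i in X) (arc s i u w : nat) = A u w.
  have [/existsP[i /andP[iX iuw]]|nA] := boolP (A u w).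
    rewrite (bigD1 i) //= iuw big1 // => j /andP[_ ji].
    by apply/eqP; rewrite eqb0; apply: contraNN ji => /arc_uniq/(_ iuw) ->.
  rewrite big1 // => i iX; apply/eqP; rewrite eqb0.
  by apply: contraNN nA => iuw; apply/existsP; exists i; rewrite iX.
have out_in i u : \sum_w (arc s i u w : nat) = \sum_w (arc s i w u : nat).
  have [/existsP[w uw]|nu] := boolP (vertex_of i u).
    have [z [xyz E]] : exists z, exists w, arc s i z u /\ arc s i u w.
      have : arc s i u w || arc s i w u by case: (s); rewrite /= uw ?orbT.
      case/orP => h; have [z [_ E]] := arc_rot h.
        by exists z, w; rewrite !E !inE !eqxx !orbT.
      by exists w, z; rewrite !E !inE !eqxx !orbT.
    case: E => zu uE.
    rewrite (bigD1 xyz) //= [RHS](bigD1 z) //= uE zu !big1 // => t; apply: contraNeq.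
      by rewrite eqb0 negbK => tu; apply/eqP; move: tu zu; rewrite -!(arcN s); exact: arc_out_uniq.
    by rewrite eqb0 negbK => /arc_out_uniq/(_ uE) ->.
  rewrite !big1 // => t _; apply/eqP; rewrite eqb0; apply: contraNN nu.
    exact: arc_vtr.
  exact: arc_vtl.
have balA u : \sum_w (A u w : nat) = \sum_w (A w u : nat).
  under eq_bigr => w _ do rewrite -sumA.
  under [RHS]eq_bigr => w _ do rewrite -sumA.
  by rewrite exchange_big [RHS]exchange_big /=; apply: eq_bigr => i _.
have dE u w : (boundary s X u w : nat) + (A u w && A w u) = A u w.
  by rewrite /boundary -/(A u w) -/(A w u); case: (A u w) (A w u) => [] [].
have bal u : \sum_w (boundary s X u w : nat) = \sum_w (boundary s X w u : nat).
  apply: (@addIn (\sum_w (A u w && A w u : nat))).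
  rewrite -big_split /=; under eq_bigr => w _ do rewrite dE.
  rewrite balA -big_split /=; apply: eq_bigr => w _.
  by rewrite andbC dE.
move=> xy; apply/existsP; apply: contraTT xy => /existsPn ny.
have := bal y; rewrite big1; last by move=> w _; apply/eqP; rewrite eqb0.
by move/esym/eqP; rewrite sum_nat_eq0 => /forall_inP/(_ x isT); rewrite eqb0.
Qed.

(** The last triangle of [X] has a vertex lying in no earlier triangle, and its arc out of that
    vertex cannot be cancelled. *)
Lemma boundary_nonempty s X : X != set0 -> exists x y, boundary s X x y.
Proof.
case/set0Pn => i0 i0X.
have [i iX imax] : exists2 i, i \in X & forall j, j \in X -> j <= i.
  by case: (@arg_maxnP _ i0 (mem X) val i0X) => i iX H; exists i.
have [v iv nv] := new_vt i.
have [y vy] : exists y, arc s i v y.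
  case/existsP: iv => w vw.
  have : arc s i v w || arc s i w v by case: (s); rewrite /= vw ?orbT.
  case/orP => h; first by exists w.
  by have [z [_ E]] := arc_rot h; exists z; rewrite E !inE eqxx orbT.
exists v, y; apply: (arc_boundary iX vy) => j jX.
have [ji|ij|/val_inj ->] := ltngtP j i; last exact: arc_asym vy.
  by apply: contraNN (nv _ ji); exact: arc_vtr.
by have := imax j jX; rewrite leqNgt ij.
Qed.

(** * Separation in terms of regions *)

Definition contains s X (O : orientation) := [forall x, forall y, boundary s X x y ==> ((x, y) \in O)].

Lemma containsP s X (O : orientation) : reflect (forall x y, boundary s X x y -> (x, y) \in O) (contains s X O).
Proof.
apply: (iffP forallP) => [H x y|H x]; first by move/forallP: (H x) => /(_ y)/implyP.
by apply/forallP => y; apply/implyP => /H.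
Qed.

(** Every boundary arc has a successor, so the boundary contains a directed cycle even when [X] is
    disconnected. Its length is at least 3 because no boundary arc occurs together with its
    reverse. *)
Lemma opposite_not_separated s X (O1 O2 : orientation) : X != set0 ->
  contains s X O1 -> contains (~~ s) X O2 -> ~ separated D O1 O2.
Proof.
move=> X0 /containsP H1 /containsP H2; apply.
have [x [y xy]] := boundary_nonempty s X0.
have [c [uc c0 cc]] := exists_uniq_cycle xy (@boundary_balanced s X).
exists c; split.
- split=> //; last first.
    by apply: sub_cycle cc => u w /boundary_arc[i _ [/gedge_arc]].
  have asym u w : boundary s X u w -> ~~ boundary s X w u.
    move=> /boundary_arc[i iX [uw nX]]; apply/negP => /boundary_arc[j jX [wu _]].
    by have := nX j jX; rewrite wu.
  case: c uc c0 cc => [//|a [|b [|//]]] _ _ /=.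
    by rewrite andbT => aa; have := asym _ _ aa; rewrite aa.
  by rewrite andbT => /andP[ab ba]; have := asym _ _ ab; rewrite ba.
- by apply: sub_cycle cc => u w /H1.
rewrite /directed_along rev_cycle; apply: sub_cycle cc => u w uw.
by apply: H2; rewrite boundaryN.
Qed.

Lemma early_vertex_all x : early_vertex N x.
Proof.
have : exists y, gedge D x y.
  have [xn|xn] := ltnP x n.+1.
    by exists (Ordinal (xn : x.+1 < n.+2)); rewrite /gedge /side /= eqxx.
  exists ord0; rewrite /gedge /side /=; have /eqP := xn; have := ltn_ord x; lia.
case=> y /(arc_gedge true)[i xy]; apply/existsP; exists i; rewrite ltn_ord /=.
by case/orP: xy => [/arc_vtl|/arc_vtr].
Qed.

Lemma separated_regions (O1 O2 : orientation) :
  (forall X s, subtree X -> contains s X O1 -> contains (~~ s) X O2 -> False) ->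
  separated D O1 O2.
Proof.
move=> H [c [[uc sc cc] d1 d2]].
have [|s [X [tX _ E]]] := cycle_region (leqnn N) uc sc cc; first by apply/allP => x _; exact: early_vertex_all.
apply: (H X s tX); apply/containsP => x y; first by move: x y; apply/E.
rewrite boundaryN => xy; move: d2; rewrite /directed_along rev_cycle => /E; exact.
Qed.

(** * Branches of the dual tree and cuts along a diagonal *)

Definition desc i := [set j | connect (fun j k => (k == p j) && (k < j)) j i].

Lemma desc_refl i : i \in desc i.
Proof. by rewrite inE connect0. Qed.

Lemma desc_child i j : p j < j -> p j \in desc i -> j \in desc i.
Proof.
by rewrite !inE => pj; apply: connect_trans; apply: connect1; rewrite eqxx.
Qed.

Lemma desc_parent i j : j \in desc i -> j != i -> p j < j /\ p j \in desc i.
Proof.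
rewrite !inE => /connectP[[|k s]] /=; first by move=> _ ->; rewrite eqxx.
case/andP => /andP[/eqP -> pj] ps il _; split=> //; apply/connectP; by exists s.
Qed.

Lemma desc_le i j : j \in desc i -> i <= j.
Proof.
have [m] := ubnP (val j); elim: m j => // m IH j jm ji.
have [-> //|/(desc_parent ji)[pj pji]] := eqVneq j i.
by apply: leq_trans (IH _ (leq_trans pj jm) pji) (ltnW pj).
Qed.

Lemma desc_cross s i j k x y : p i < i -> arc s j x y -> arc s k y x ->
  j \in desc i -> k \notin desc i -> j = i /\ k = p i.
Proof.
move=> pi jxy kyx ji ki.
have [jk|kj|/val_inj jk] := ltngtP j k; last by rewrite jk (negPf ki) in ji.
  have jE := arc_parent jxy kyx jk; move: ki; rewrite desc_child // -jE //.
have kE := arc_parent kyx jxy kj.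
have [jE|/(desc_parent ji)[_]] := eqVneq j i; first by rewrite kE jE.
by rewrite -kE (negPf ki).
Qed.

Definition total (O : orientation) := [forall x, forall y,
  if gedge D x y then ((x, y) \in O) (+) ((y, x) \in O) else (x, y) \notin O].

Lemma totalP (O : orientation) : reflect (total_orientation D O) (total O).
Proof.
apply: (iffP forallP) => [H|[H1 H2] x].
  have {}H x y := forallP (H x) y; split=> x y; have := H x y; case: ifP => //.
  by move=> _ /negPf ->.
apply/forallP => y; case: ifP => [|/negP xy]; first exact: H2.
by apply/negP => /H1.
Qed.

Lemma total_arc (O : orientation) x y : total O -> gedge D x y -> ((y, x) \in O) = ((x, y) \notin O).
Proof. by move=> /forallP/(_ x)/forallP/(_ y) + xy; rewrite xy; do 2!case: (_ \in O). Qed.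

(** The only possible cancellation between the two parts is along the diagonal above [i]. When that
    diagonal is not inside [X], both boundaries consist of boundary arcs of [X]. *)
Lemma contains_split s X i (O : orientation) : p i < i -> contains s X O ->
  ~~ ((i \in X) && (p i \in X)) ->
  contains s (X :&: desc i) O /\ contains s (X :\: desc i) O.
Proof.
move=> pi /containsP XO nX.
split; apply/containsP => x y /boundary_arc[j]; rewrite (in_setI, in_setD) => /andP[jX jH] [jxy nrev].
  apply: XO; apply: (arc_boundary jX jxy) => k kX; apply/negP => kyx.
  have [kH|kH] := boolP (k \in desc i).
    by have := nrev k; rewrite in_setI kX kH kyx => /(_ isT).
  have [jE kE] := desc_cross pi jxy kyx jH kH.
  by move: nX; rewrite -jE jX jE -kE kX.
apply: XO; apply: (arc_boundary jH jxy) => k kX; apply/negP => kyx.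
have [kH|kH] := boolP (k \in desc i); last first.
  by have := nrev k; rewrite in_setD kX kH kyx => /(_ isT).
have [kE jE] := desc_cross pi kyx jxy kH jX.
by move: nX; rewrite -jE jH -kE kX.
Qed.

(* An orientation of the boundary of [X] extended by an orientation of the
   diagonal cutting [X] directs one of the two halves. *)
Lemma contains_cut s X i (O : orientation) : p i < i -> total O -> contains s X O ->
  contains s (X :&: desc i) O \/ contains s (X :\: desc i) O.
Proof.
move=> pi tO XO.
have [|nX] := boolP ((i \in X) && (p i \in X)); last by have [] := contains_split pi XO nX; left.
case/andP => iX piX; have [u [w [uw wu]]] := arc_parent_edge s pi.
move/containsP: XO => XO.
have [uwO|] := boolP ((u, w) \in O); [left|rewrite -total_arc ?(gedge_arc uw) // => wuO; right].
  apply/containsP => x y /boundary_arc[j]; rewrite in_setI => /andP[jX jH] [jxy nrev].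
  have [/existsP[k /andP[kX kyx]]|/existsPn nk] := boolP [exists k in X, arc s k y x]; last first.
    by apply: XO; apply: (arc_boundary jX jxy) => k kX; have := nk k; rewrite kX.
  have [kH|kH] := boolP (k \in desc i).
    by have := nrev k; rewrite in_setI kX kH kyx => /(_ isT).
  have [jE kE] := desc_cross pi jxy kyx jH kH; subst j k.
  by have [<- <-] := arc_shared_uniq pi uw wu jxy kyx.
apply/containsP => x y /boundary_arc[j]; rewrite in_setD => /andP[jH jX] [jxy nrev].
have [/existsP[k /andP[kX kyx]]|/existsPn nk] := boolP [exists k in X, arc s k y x]; last first.
  by apply: XO; apply: (arc_boundary jX jxy) => k kX; have := nk k; rewrite kX.
have [kH|kH] := boolP (k \in desc i); last first.
  by have := nrev k; rewrite in_setD kX kH kyx => /(_ isT).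
have [kE jE] := desc_cross pi kyx jxy kH jH; subst j k.
by have [<- <-] := arc_shared_uniq pi uw wu kyx jxy.
Qed.

(** * From a separated collection to a biclosed family *)

Section Closure.
Variable S : {set orientation}.
Hypothesis sepS : pairwise_separated D S.

(** Members may be disconnected and the two sets united need not be adjacent; cuts can therefore be
    carried out on each summand separately. *)
Inductive closure : {set 'I_N} -> Prop :=
| closure_base X O of O \in S & contains true X O : closure X
| closure_union X Y of [disjoint X & Y] & closure X & closure Y : closure (X :|: Y).

Lemma closure_split X i : p i < i -> closure X -> ~~ ((i \in X) && (p i \in X)) ->
  closure (X :&: desc i) /\ closure (X :\: desc i).
Proof.
move=> pi; elim=> {X} [X O OS XO nX|X Y XY _ IHX _ IHY].
  by have [? ?] := contains_split pi XO nX; split; apply: closure_base OS _.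
rewrite !inE !negb_and !negb_or => nXY.
have [|XI XD] := IHX; first by case/orP: nXY => /andP[/negPf ->]; rewrite ?andbF.
have [|YI YD] := IHY; first by case/orP: nXY => /andP[_ /negPf ->]; rewrite ?andbF.
rewrite setIUl setDUl; split; apply: closure_union => //.
  by apply: disjointWl (subsetIl _ _) _; apply: disjointWr (subsetIl _ _) _.
by apply: disjointWl (subsetDl _ _) _; apply: disjointWr (subsetDl _ _) _.
Qed.

(** In a disjoint union at most one summand contains both triangles at the diagonal. The other
    summand splits into two members of the closure, so whichever half the first provides can be
    completed. *)
Lemma closure_cut X i : p i < i -> closure X ->
  closure (X :&: desc i) \/ closure (X :\: desc i).
Proof.
move=> pi; elim=> {X} [X O OS XO|X Y XY cX IHX cY IHY].
  have /totalP tO := sepS.1 _ OS.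
  by have [?|?] := contains_cut pi tO XO; [left|right]; apply: closure_base OS _.
have dI : [disjoint X :&: desc i & Y :&: desc i].
  by apply: disjointWl (subsetIl _ _) _; apply: disjointWr (subsetIl _ _) _.
have dD : [disjoint X :\: desc i & Y :\: desc i].
  by apply: disjointWl (subsetDl _ _) _; apply: disjointWr (subsetDl _ _) _.
rewrite setIUl setDUl.
have [/andP[iX _]|/(closure_split pi cX)[XI XD]] := boolP ((i \in X) && (p i \in X)).
  have /(closure_split pi cY)[YI YD] : ~~ ((i \in Y) && (p i \in Y)).
    by rewrite (disjointFr XY iX).
  by case: IHX => ?; [left|right]; apply: closure_union.
by case: IHY => ?; [left|right]; apply: closure_union.
Qed.

Lemma contains_opposite s X (O1 O2 : orientation) : O1 \in S -> O2 \in S -> X != set0 ->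
  contains s X O1 -> contains (~~ s) X O2 -> False.
Proof.
move=> S1 S2 X0 X1 X2; have [O12|ne] := eqVneq O1 O2; last first.
  by have := opposite_not_separated X0 X1 X2; apply; exact: sepS.2.
have /totalP tO := sepS.1 _ S1; have [x [y xy]] := boundary_nonempty s X0.
have /containsP/(_ _ _ xy) := X1; have := X2; rewrite -O12 => /containsP/(_ y x).
rewrite boundaryN => /(_ xy); have [i _ [/gedge_arc g _]] := boundary_arc xy.
by rewrite (total_arc tO g) => /negP.
Qed.

(** Induction on the size of the region. A union directed negatively is cut along a tree edge
    joining the two summands, which leaves a smaller member of the closure directed negatively; if
    there is no such edge, the first summand is itself directed negatively. *)
Lemma closure_not_negative X (O : orientation) :
  O \in S -> X != set0 -> closure X -> ~ contains false X O.
Proof.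
move=> OS; have [m] := ubnP #|X|; elim: m X => // m IH X Xm X0 cX.
elim: cX X0 Xm => {X} [X O' OS' XO' X0 _ XO|X Y XY cX IHX cY IHY].
  exact: contains_opposite OS' OS X0 XO' XO.
have [->|X0] := eqVneq X set0; first by rewrite set0U.
have [->|Y0] := eqVneq Y set0; first by rewrite setU0.
move=> _; have cardXY : #|X :|: Y| = #|X| + #|Y|.
  by apply/eqP; rewrite (leq_card_setU X Y).2.
rewrite cardXY => XYm XYO.
have Xm : #|X| < m.
  by rewrite -card_gt0 in Y0; rewrite -ltnS; apply: leq_ltn_trans XYm; rewrite -addn1 leq_add2l.
have cXY : closure (X :|: Y) by exact: closure_union.
have [/existsP[i /and3P[pi /andP[iXY piXY] cross]]|/existsPn ncross] := boolP [exists i,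
    [&& p i < i, (i \in X :|: Y) && (p i \in X :|: Y) & (i \in X) (+) (p i \in X)]].
  have nX : ~~ ((i \in X) && (p i \in X)) by move: cross; case: (i \in X); case: (p i \in X).
  have nY : ~~ ((i \in Y) && (p i \in Y)).
    move: cross; case iX: (i \in X); first by rewrite (disjointFr XY iX).
    by case pX: (p i \in X); rewrite // (disjointFr XY pX) andbF.
  have [XI XD] := closure_split pi cX nX; have [YI YD] := closure_split pi cY nY.
  have cI : closure ((X :|: Y) :&: desc i).
    rewrite setIUl; apply: closure_union => //.
    by apply: disjointWl (subsetIl _ _) _; apply: disjointWr (subsetIl _ _) _.
  have cD : closure ((X :|: Y) :\: desc i).
    rewrite setDUl; apply: closure_union => //.
    by apply: disjointWl (subsetDl _ _) _; apply: disjointWr (subsetDl _ _) _.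
  have I0 : (X :|: Y) :&: desc i != set0.
    by apply/set0Pn; exists i; rewrite in_setI iXY desc_refl.
  have npi : p i \notin desc i by apply/negP => /desc_le; rewrite leqNgt pi.
  have D0 : (X :|: Y) :\: desc i != set0.
    by apply/set0Pn; exists (p i); rewrite in_setD npi.
  have cardID := cardsID (desc i) (X :|: Y).
  have /totalP tO := sepS.1 _ OS.
  have := I0; have := D0; rewrite -!card_gt0 => Dg Ig.
  case: (contains_cut pi tO XYO); apply: IH => //; rewrite -ltnS; apply: leq_ltn_trans XYm; rewrite -cardXY -cardID.
    by rewrite -addn1 leq_add2l.
  by rewrite -add1n leq_add2r.
apply: (IH X) => //; apply/containsP => x y /boundary_arc[j jX [jxy nrev]].
move/containsP: XYO; apply; apply: (arc_boundary _ jxy); first by rewrite inE jX.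
move=> k; rewrite inE => /orP[/nrev//|kY]; apply/negP => kyx.
have kX := disjointFl XY kY.
have [jk|kj|/val_inj jk] := ltngtP j k; last by rewrite jk kX in jX.
  have jE := arc_parent jxy kyx jk; have := ncross k; rewrite -jE jk !inE jX kY kX.
  by rewrite orbT.
have kE := arc_parent kyx jxy kj; have := ncross j; rewrite -kE kj !inE jX kY kX.
by rewrite orbT.
Qed.
End Closure.

Definition top_of X r := r \in X /\ forall i, i \in X -> i != r -> p i < i /\ p i \in X.

Lemma top_le X r i : top_of X r -> i \in X -> r <= i.
Proof.
case=> _ H; have [m] := ubnP (val i); elim: m i => // m IH i im iX.
have [->//|/(H i iX)[pi piX]] := eqVneq i r.
by apply: leq_trans (IH _ (leq_trans pi im) piX) (ltnW pi).
Qed.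

Lemma subtree_top X : subtree X -> exists r, top_of X r.
Proof. by case/subtreeP => r; exists r. Qed.

Lemma top_subtree X r : top_of X r -> subtree X.
Proof. by case=> rX H; apply/subtreeP; exists r. Qed.

Lemma subtree_neq0 X : subtree X -> X != set0.
Proof. by case/subtree_top => r [rX _]; apply/set0Pn; exists r. Qed.

Lemma top_desc X r : top_of X r -> X :&: desc r = X.
Proof.
move=> topr; apply/setIidPl/subsetP => i; have [m] := ubnP (val i).
elim: m i => // m IH i im iX; have [->|ir] := eqVneq i r; first exact: desc_refl.
by have [pi piX] := topr.2 _ iX ir; apply: desc_child => //; apply: IH => //; exact: (leq_trans pi im).
Qed.

Lemma top_setI X r i : top_of X r -> i \in X -> top_of (X :&: desc i) i.
Proof.
case=> rX H iX; split=> [|j]; first by rewrite in_setI iX desc_refl.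
rewrite !in_setI => /andP[jX ji] ne; have [pj pji] := desc_parent ji ne.
split=> //; rewrite pji andbT; apply: (H j jX _).2; apply: contraTneq pji => jr.
by apply/negP => /desc_le; have := top_le (conj rX H) iX; rewrite -jr leqNgt; lia.
Qed.

Lemma top_setD X r i : top_of X r -> i \in X -> p i < i -> i != r -> top_of (X :\: desc i) r.
Proof.
move=> topr iX pi ir; split=> [|j].
  rewrite in_setD topr.1 andbT; apply/negP => /desc_le; have := top_le topr iX.
  by rewrite leq_eqVlt eq_sym (inj_eq val_inj) (negPf ir) /= ltnNge => /negPf ->.
rewrite !in_setD => /andP[ji jX] jr; have [pj pjX] := topr.2 _ jX jr.
by split=> //; rewrite pjX andbT; apply: contraNN ji; exact: desc_child.
Qed.

Definition biclosed (A : {set {set 'I_N}}) := forall X i,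
  subtree X -> i \in X -> p i \in X -> p i < i ->
  (X :&: desc i \in A) = (X :\: desc i \in A) -> (X \in A) = (X :&: desc i \in A).

Definition compatible (A : {set {set 'I_N}}) : {set orientation} :=
  [set O | total O && [forall X, subtree X ==> [forall s, contains s X O ==> ((X \in A) == s)]]].

Lemma compatibleP (A : {set {set 'I_N}}) (O : orientation) : reflect
  (total_orientation D O /\ forall X s, subtree X -> contains s X O -> (X \in A) = s)
  (O \in compatible A).
Proof.
rewrite inE; apply: (iffP andP) => -[/totalP tO H]; split=> //.
  by move=> X s tX XO; have /forallP/(_ X)/implyP/(_ tX)/forallP/(_ s)/implyP/(_ XO)/eqP := H.
apply/forallP => X; apply/implyP => tX; apply/forallP => s; apply/implyP => XO.
by apply/eqP; exact: H.
Qed.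

Lemma compatible_separated (A : {set {set 'I_N}}) : pairwise_separated D (compatible A).
Proof.
split=> [O /compatibleP[]//|O1 O2 /compatibleP[_ H1] /compatibleP[_ H2] _].
apply: separated_regions => X s tX /H1 XA /H2; rewrite XA //.
by move/(_ tX); case: (s).
Qed.

(** [A] consists of the subtrees in the closure of [S]. Every member of [S] is compatible with [A],
    and compatible orientations are pairwise separated, so maximality forces equality. *)
Lemma maximal_compatible (S : {set orientation}) : maximal_separated D S ->
  exists A : {set {set 'I_N}},
    [/\ biclosed A, forall X, X \in A -> subtree X & S = compatible A].
Proof.
move=> [sepS maxS].
pose A := [set X | subtree X && `[< closure S X >]].
have AE X : subtree X -> reflect (closure S X) (X \in A).
  by move=> tX; rewrite inE tX; exact: asboolP.
have sub : S \subset compatible A.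
  apply/subsetP => O OS; apply/compatibleP; split; first exact: sepS.1.
  move=> X [] tX XO; first by apply/(AE _ tX); exact: closure_base OS XO.
  apply/negbTE/negP=> /(AE _ tX) cX.
  exact: (closure_not_negative sepS OS (subtree_neq0 tX) cX XO).
exists A; split.
- move=> X i tX iX piX pi; have [r topr] := subtree_top tX.
  have ir : i != r by apply: contraTneq piX => ir; apply/negP => /(top_le topr); rewrite leqNgt -ir pi.
  have AI := AE _ (top_subtree (top_setI topr iX)).
  have AD := AE _ (top_subtree (top_setD topr iX pi ir)).
  (* When the halves agree, a positive [X] has a positive half by [closure_cut], and conversely two
     positive halves have a positive union. *)
  move=> E; apply/(AE _ tX)/idP => [|XI].
    by case/(closure_cut sepS pi) => [/AI //|/AD]; rewrite E.
  rewrite -(setID X (desc i)); apply: closure_union; last by apply/AD; rewrite -E.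
    rewrite -setI_eq0; apply/eqP/setP => j; rewrite !in_setI in_setD in_set0.
    by case: (j \in desc i); rewrite ?andbF.
  exact/AI.
- by move=> X; rewrite inE => /andP[].
apply/eqP; rewrite eqEsubset sub; apply/subsetP => O /[dup] OA /compatibleP[tO _].
apply: contraT => OS; case: (maxS _ tO OS); have [H1 H2] := compatible_separated A.
have OSA O' : O' \in O |: S -> O' \in compatible A.
  by rewrite in_setU1 => /orP[/eqP ->//|]; exact: (subsetP sub).
by split=> [O' /OSA/H1//|O1 O2 /OSA O1A /OSA]; exact: H2.
Qed.

(** Edges not prescribed by [P] are directed from the smaller to the larger endpoint. *)
Lemma orientation_extending (P : rel V) : (forall x y, P x y -> gedge D x y) ->
  (forall x y, P x y -> ~~ P y x) ->
  exists2 O : orientation, total O & forall x y, P x y -> (x, y) \in O.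
Proof.
move=> Pg Pa.
exists [set e : V * V | gedge D e.1 e.2 && (P e.1 e.2 || ~~ P e.2 e.1 && (e.1 < e.2))].
  apply/forallP => x; apply/forallP => y; rewrite !inE /= [gedge D y x]gedge_sym.
  case xy: (gedge D x y) => //=; case Pxy: (P x y); first by rewrite (negPf (Pa _ _ Pxy)).
  case Pyx: (P y x) => //=.
  by have := gedge_neq xy; rewrite -(inj_eq val_inj) /=; case: ltngtP.
by move=> x y xy; rewrite inE /= xy (Pg _ _ xy).
Qed.

(** * From a biclosed family to orientations *)

Section Realization.
Variable A : {set {set 'I_N}}.
Hypothesis bicA : biclosed A.

(** The branches outside [Y] are removed one at a time: as the removed branch has sign [~~ s] and
    the whole has sign [s], biclosedness forces the remainder to have sign [s]. *)
Lemma biclosed_part s X Y r : top_of X r -> top_of Y r -> Y \subset X -> (X \in A) = s ->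
  (forall i, i \in X -> i \notin Y -> p i < i -> p i \in Y -> (X :&: desc i \in A) = ~~ s) ->
  (Y \in A) = s.
Proof.
move=> topX topY; have [m] := ubnP #|X|; elim: m X topX => // m IH X topX Xm YX XA H.
have [YE|] := eqVneq Y X; first by rewrite YE.
rewrite eqEsubset YX /= => /subsetPn[i0 i0X i0Y].
pose P := [pred i | (i \in X) && (i \notin Y)].
(* Minimality of [i] puts its parent in [Y]. *)
have [i /andP[iX iY] imin] : exists2 i, P i & forall j, P j -> i <= j.
  by case: (@arg_minnP _ i0 P val) => [|i Pi]; [rewrite /= i0X|exists i].
have ir : i != r by apply: contraNneq iY => ->; exact: topY.1.
have [pi piX] := topX.2 _ iX ir.
have piY : p i \in Y.
  apply: contraT => npi; have := imin (p i); rewrite /= piX npi leqNgt pi.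
  by move=> /(_ isT).
have descY k : k \in X -> k \notin Y -> forall j, j \in Y -> j \notin desc k.
  move=> kX kY j; have [m'] := ubnP (val j); elim: m' j => // m' IH' j jm jY.
  apply/negP => jk; have jk' : j != k by apply: contraNneq kY => <-.
  have [pj pjk] := desc_parent jk jk'.
  have [jr|jr] := eqVneq j r; last first.
    have [_ pjY] := topY.2 _ jY jr.
    by have := IH' _ (leq_trans pj jm) pjY; rewrite pjk.
  have := desc_le pjk; have := top_le topX kX; rewrite -jr => jk2 kpj.
  by have := leq_trans jk2 kpj; rewrite leqNgt pj.
have topZ := top_setD topX iX pi ir.
apply: (IH (X :\: desc i)) => //.
- rewrite -ltnS; apply: leq_trans Xm; rewrite -(cardsID (desc i) X) ltnS -add1n leq_add2r.
  by rewrite card_gt0; apply/set0Pn; exists i; rewrite in_setI iX desc_refl.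
- by apply/subsetP => j jY; rewrite in_setD (descY i) // (subsetP YX).
- have := bicA (top_subtree topX) iX piX pi; rewrite (H i) // XA.
  by case: (_ :\: _ \in A) (s) => [] [] // /(_ erefl).
move=> k; rewrite in_setD => /andP[ki kX] kY pk pkY.
(* Within [X] the branch at [k] is disjoint from the removed one, so its trace is unchanged. *)
rewrite -(H k) //; congr (_ \in A); apply/setP => j; rewrite !in_setI in_setD.
have [jk|] := boolP (j \in desc k); rewrite ?andbF // !andbT.
have [jX|] := boolP (j \in X); rewrite ?andbF // andbT.
have [m'] := ubnP (val j); elim: m' j jk jX => // m' IH' j jk jX jm.
apply/negP => ji; have jk' : j != k by apply: contraTneq ji => ->.
have [ji'|ji'] := eqVneq j i; last first.
  have [pj pjk] := desc_parent jk jk'; have [_ pji] := desc_parent ji ji'.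
  have jr : j != r by apply: contraTneq ji => ->; apply: (descY i) => //; exact: topY.1.
  have pjX := (topX.2 _ jX jr).2.
  by have := IH' _ pjk pjX (leq_trans pj jm); rewrite pji.
have [_ pik] : p i < i /\ p i \in desc k by rewrite -ji'; apply: desc_parent.
by have := descY k kX kY _ piY; rewrite pik.
Qed.

Definition good X (O : orientation) := total O /\
  forall Y s, subtree Y -> Y \subset X -> contains s Y O -> (Y \in A) = s.

(* The diagonal between [i] and its parent is directed along the branch at [i]
   exactly when that branch has the sign of [X]; the outer edge of the top
   triangle excludes regions of the opposite sign containing it. *)
Lemma good_within X : subtree X ->
  exists2 O, good X O & contains (X \in A) X O.
Proof.
move=> tX; have [r topr] := subtree_top tX; set s := (X \in A).
pose b i := (X :&: desc i \in A) == s.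
pose Q i x y := [&& p i < i, i \in X & p i \in X] &&
  (if b i then arc s i x y && arc s (p i) y x else arc s i y x && arc s (p i) x y).
pose P x y := boundary s X x y || [exists i, Q i x y].
have PQ x y : boundary s X x y -> ~~ P y x.
  case/boundary_arc => i iX [ixy nrev]; apply/orP => -[/boundary_arc[j jX [jyx _]]|].
    by have := nrev j jX; rewrite jyx.
  case/existsP => j; rewrite /Q => /andP[/and3P[pj jX pjX]].
  by case: (b j) => /andP[h1 h2]; [have := nrev _ jX; rewrite h1|have := nrev _ pjX; rewrite h2].
have QQ i j x y : Q i x y -> ~~ Q j y x.
  rewrite /Q => /andP[/and3P[pi iX piX] qi]; apply/negP => /andP[/and3P[pj jX pjX]].
  have loop : j = p i -> i = p j -> False by move=> jE iE; move: pi pj; rewrite -jE -iE; lia.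
  case bj: (b j) => /andP[j1 j2]; move: qi; case bi: (b i) => /andP[i1 i2].
  - by apply: loop; [exact: arc_uniq j1 i2|exact: arc_uniq i1 j2].
  - by have ij := arc_uniq i1 j1; rewrite ij bj in bi.
  - by have ij := arc_uniq i1 j1; rewrite ij bj in bi.
  - by apply: loop; [exact: arc_uniq j1 i2|exact: arc_uniq i1 j2].
have [|x y|O tO PO] := @orientation_extending P.
- move=> x y /orP[/boundary_arc[i _ [/gedge_arc]] //|/existsP[i /andP[_]]].
  by case: (b i) => /andP[_ /gedge_arc //]; rewrite gedge_sym.
- case/orP => [/PQ//|/existsP[i qi]]; apply/orP => -[|/existsP[j qj]].
    by move/PQ/negP; apply; apply/orP; right; apply/existsP; exists i.
  by have := QQ _ j _ _ qi; rewrite qj.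
have XO : contains s X O by apply/containsP => x y xy; apply: PO; rewrite /P xy.
exists O => //; split=> // Y s' tY YX /containsP YO; have [y topy] := subtree_top tY.
have inX j : j \in Y -> j \in X by apply/subsetP.
have edge i x z : p i < i -> i \in X -> p i \in X -> arc s i x z -> arc s (p i) z x ->
    ((x, z) \in O) = b i.
  move=> pi iX piX xz zx; case bi: (b i).
    by apply: PO; apply/orP; right; apply/existsP; exists i; rewrite /Q pi iX piX bi xz zx.
  apply/negbTE; rewrite -(total_arc tO (gedge_arc xz)); apply: PO.
  by apply/orP; right; apply/existsP; exists i; rewrite /Q pi iX piX bi xz zx.
have YE : s' = s \/ s' = ~~ s by case: (s) (s') => [] []; auto.
have dY j x z : j \in Y -> arc s j x z -> (forall k, k \in Y -> ~~ arc s k z x) ->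
    ((x, z) \in O) = (s' == s).
  move=> jY xz nrev; have xzY := arc_boundary jY xz nrev.
  case: YE => sE; rewrite sE in YO *; first by rewrite eqxx YO.
  have : (z, x) \in O by apply: YO; rewrite boundaryN.
  by rewrite (total_arc tO (gedge_arc xz)); case: (_ \in O) (s) => [] [].
(* [Y] arises from the branch of [X] at [y] by cutting off branches. The direction of the edge above
   [y] gives that branch the sign [s'], and the diagonals below [Y] give the removed branches the
   opposite sign. *)
apply: (biclosed_part (X := X :&: desc y) (r := y)) => //.
- exact: top_setI topr (inX _ topy.1).
- apply/subsetP => j jY; have : j \in Y :&: desc y by rewrite (top_desc topy).
  by rewrite !in_setI => /andP[/inX ->].
(* When [y] is the top of [X], the free outer edge lies on the boundaries of both [X] and [Y] and
   forces [s' = s]. *)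
- have [yr|yr] := eqVneq y r.
    rewrite yr (top_desc topr).
    have [u [w [uw nout]]] : exists u w, arc s r u w /\ forall j, arc s j w u -> j < r.
      have [u [w [uw nout]]] := outer_edge disk r.
      by case: (s); [exists u, w|exists w, u].
    have nrev j : j \in X -> ~~ arc s j w u.
      by move=> jX; apply/negP => /nout; have := top_le topr jX; rewrite leqNgt => /negP.
    have rY : r \in Y by rewrite -yr; exact: topy.1.
    have := dY r u w rY uw (fun j jY => nrev j (inX _ jY)).
    have -> : (u, w) \in O by move/containsP: XO; apply; exact: arc_boundary topr.1 uw nrev.
    by move/esym/eqP.
  have [py pyX] := topr.2 _ (inX _ topy.1) yr; have [u [w [uw wu]]] := arc_parent_edge s py.
  have := edge y u w py (inX _ topy.1) pyX uw wu.
  rewrite (dY y) //; first by rewrite /b; case: (_ \in A) (s) (s') => [] [] [].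
    exact: topy.1.
  move=> k kY; apply/negP => kwu; have kE := arc_uniq kwu wu; subst k.
  by have := top_le topy kY; rewrite leqNgt py.
move=> i; rewrite in_setI => /andP[iX iy] iY pi piY.
have -> : X :&: desc y :&: desc i = X :&: desc i.
  rewrite -setIA; congr (_ :&: _); apply/setIidPr/subsetP => j ji.
  by move: ji iy; rewrite !inE; exact: connect_trans.
have [u [w [uw wu]]] := arc_parent_edge s pi.
have := edge i u w pi iX (inX _ piY) uw wu.
rewrite (total_arc tO (gedge_arc wu)) (dY (p i)) //.
  by rewrite /b; case: (_ \in A) (s) (s') => [] [] [].
by move=> k kY; apply/negP => kuw; rewrite (arc_uniq kuw uw) (negPf iY) in kY.
Qed.

(** If the top of [X] is not the root, its parent is added; otherwise the triangle of least index
    outside [X], whose parent then lies in [X]. *)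
Lemma outer_triangle X : subtree X -> X != setT -> exists k x y,
  [/\ k \notin X, subtree (k |: X), bd k x y &
      forall i u w, i \in X -> bd k u w -> bd i w u -> u = x /\ w = y].
Proof.
case/subtree_top => r topr nT; have [r0|r0] := posnP (val r); last first.
  have pr := parent_lt disk r0; have [a [c [ac ca]]] := parent_edge disk pr.
  have prX : p r \notin X by apply/negP => /(top_le topr); rewrite leqNgt pr.
  exists (p r), c, a; split=> //.
    apply: (@top_subtree _ (p r)); split=> [|i]; first by rewrite !inE eqxx.
    rewrite in_setU1 => /orP[/eqP ->|iX _]; first by rewrite eqxx.
    have [->|ir] := eqVneq i r; first by rewrite setU11.
    by have [? ?] := topr.2 _ iX ir; rewrite setU1r.
  move=> i u w iX uw wu; have ri := top_le topr iX.
  have ir : i = r.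
    apply/eqP; apply: contraNT prX => ir; have [_ piX] := topr.2 _ iX ir.
    by rewrite (@arc_parent true _ _ _ _ uw wu) //; apply: leq_trans ri.
  by rewrite ir in wu; have [-> ->] := @arc_shared_uniq true _ _ _ _ _ pr ac ca wu uw.
have /subsetPn[k0 _ k0X] : ~~ (setT \subset X) by rewrite subTset.
have [k kX kmin] : exists2 k, k \notin X & forall j, j \notin X -> k <= j.
  by case: (@arg_minnP _ k0 [pred j | j \notin X] val) => // i; exists i.
have kr : k != r by apply: contraNneq kX => ->; exact: topr.1.
have k0' : 0 < k by rewrite lt0n -r0 (inj_eq val_inj).
have pk := parent_lt disk k0'; have [a [c [ac ca]]] := parent_edge disk pk.
have pkX : p k \in X by apply: contraT => /kmin; rewrite leqNgt pk.
exists k, a, c; split=> //.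
  apply: (@top_subtree _ r); split=> [|i]; first by rewrite setU1r // topr.1.
  rewrite in_setU1 => /orP[/eqP -> _|iX ir]; first by rewrite setU1r.
  by have [? ?] := topr.2 _ iX ir; rewrite setU1r.
move=> i u w iX uw wu; have [ik|ki|/val_inj ik] := ltngtP i k.
- have iE := @arc_parent true _ _ _ _ wu uw ik; subst i.
  by have [-> ->] := @arc_shared_uniq true _ _ _ _ _ pk ac ca uw wu.
- have kE := @arc_parent true _ _ _ _ uw wu ki.
  have ir : i != r by apply: contraTneq ki => ->; rewrite -leqNgt r0.
  by have [_] := topr.2 _ iX ir; rewrite -kE (negPf kX).
by rewrite ik (negPf kX) in iX.
Qed.

(* The two free edges of the new triangle are both directed towards its apex, so
   no region using this triangle is directed. *)
Lemma good_extend X (O : orientation) : subtree X -> X != setT -> good X O ->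
  exists k (O' : orientation), [/\ k \notin X, subtree (k |: X), good (k |: X) O' &
    forall Y s, Y \subset X -> contains s Y O' = contains s Y O].
Proof.
move=> tX /(outer_triangle tX)[k [x [y [kX tkX xy kuniq]]]] [tO goodO].
have [v [xyv E]] := @arc_rot true k x y xy.
have yv : bd k y v by have := E y v; rewrite !inE eqxx orbT.
have vx : bd k v x by have := E v x; rewrite !inE eqxx !orbT.
have vnx : v != x := @arc_neq true _ _ _ vx.
have vny : v != y by have := @arc_neq true _ _ _ yv; rewrite eq_sym.
(* [T] marks the two edges of the new triangle at its apex [v]; neither belongs to a triangle of
   [X]. *)
pose T u w := (u == v) && (w \in [:: x; y]) || (w == v) && (u \in [:: x; y]).
pose O' : orientation :=
  [set e | gedge D e.1 e.2 && if T e.1 e.2 then e.2 == v else e \in O].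
have TC u w : T u w = T w u by rewrite /T orbC.
have nTX i u w : i \in X -> bd i u w -> ~~ T u w.
  move=> iX uw; rewrite /T !inE; apply/negP.
  have nk a c : bd k a c -> bd i a c -> False.
    by move=> h1 h2; rewrite (bd_uniq disk h2 h1) (negPf kX) in iX.
  case/orP => /andP[/eqP vE /orP[]/eqP wE]; subst u w.
  - exact: nk vx uw.
  - by have [yE _] := kuniq _ _ _ iX yv uw; have := @arc_neq true _ _ _ xy; rewrite yE eqxx.
  - by have [yE _] := kuniq _ _ _ iX vx uw; rewrite yE eqxx in vnx.
  - exact: nk yv uw.
have nTXs s i u w : i \in X -> arc s i u w -> ~~ T u w.
  by case: s => iX /(nTX _ _ _ iX); rewrite // TC.
have same Y s : Y \subset X -> contains s Y O' = contains s Y O.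
  move=> YX; apply: eq_forallb => u; apply: eq_forallb => w.
  case uw: (boundary s Y u w) => //=; have [i iY [iuw _]] := boundary_arc uw.
  by rewrite !inE /= (gedge_arc iuw) (negPf (nTXs _ _ _ _ (subsetP YX _ iY) iuw)).
exists k, O'; split=> //; split.
  apply/forallP => u; apply/forallP => w; rewrite !inE /= [gedge D w u]gedge_sym [T w u]TC.
  case uw: (gedge D u w) => //=; case: ifP => Tuw; last by rewrite (total_arc tO uw); case: (_ \in O).
  move: Tuw (gedge_neq uw); rewrite /T.
  by case: (u =P v) => [->|_]; case: (w =P v) => [->|_]; rewrite ?eqxx.
move=> Y s tY YkX YO'; have [kY|kY] := boolP (k \in Y); last first.
  have YX : Y \subset X.
    apply/subsetP => j jY; have := subsetP YkX _ jY; rewrite in_setU1 => /orP[/eqP jk|//].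
    by rewrite -jk jY in kY.
  by apply: goodO => //; rewrite -same.
have dirk u w : arc s k u w -> T u w -> boundary s Y u w.
  move=> kuw Tuw; apply: (arc_boundary kY kuw) => j jY.
  have := subsetP YkX _ jY; rewrite in_setU1 => /orP[/eqP ->|jX]; first exact: arc_asym kuw.
  by apply/negP => /(nTXs _ _ _ _ jX); rewrite TC Tuw.
(* A directed region containing [k] would have to leave [v] along one of the marked edges, which
   [O'] never does. *)
move/containsP: YO' => YO'; case: s dirk YO' => dirk YO'.
  have Tvx : T v x by rewrite /T !inE !eqxx.
  by have := YO' _ _ (dirk v x vx Tvx); rewrite inE /= Tvx eq_sym (negPf vnx) andbF.
have Tvy : T v y by rewrite /T !inE !eqxx orbT.
by have := YO' _ _ (dirk v y yv Tvy); rewrite inE /= Tvy eq_sym (negPf vny) andbF.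
Qed.

(** The orientation found within [X] is extended triangle by triangle; the boundary of [X] keeps its
    directions throughout. *)
Lemma compatible_contains X : subtree X ->
  exists2 O, O \in compatible A & contains (X \in A) X O.
Proof.
move=> tX; have [O gO XO] := good_within tX.
suff [O' [tO' gO'] XO'] : exists2 O', good setT O' & contains (X \in A) X O'.
  exists O' => //; apply/compatibleP; split; first exact/totalP.
  by move=> Y s tY; apply: gO' => //; apply: subsetT.
set s := (X \in A) in XO *.
have [Z [XZ tZ gZ]] : exists Z, [/\ X \subset Z, subtree Z & good Z O] by exists X.
have [m] := ubnP #|~: Z|; elim: m Z O {gO} XZ tZ gZ XO => // m IH Z O XZ tZ gZ XO Zm.
have [ZT|nT] := eqVneq Z setT; first by exists O => //; rewrite -ZT.
have [k [O' [kZ tkZ gkZ same]]] := good_extend tZ nT gZ.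
apply: (IH (k |: Z) O') => //.
- by apply: subset_trans XZ _; exact: subsetUr.
- by rewrite same.
rewrite -ltnS; apply: leq_trans Zm; rewrite ltnS; apply: proper_card.
by rewrite properC properUr // sub1set.
Qed.

(** An orientation outside the family directs some subtree against its sign, and a compatible
    orientation directs the same subtree with its sign. *)
Lemma compatible_maximal : maximal_separated D (compatible A).
Proof.
split; first exact: compatible_separated.
move=> O tO OA [_ sepO]; move/negP: OA; apply; apply/compatibleP; split=> // X s tX XO.
apply: contraTeq isT => XA; have [O' O'A XO'] := compatible_contains tX.
have {XA} XA : (X \in A) = ~~ s by case: (_ \in A) (s) XA => [] [].
rewrite XA in XO'; have [OO'|OO'] := eqVneq O O'.
  rewrite -OO' in O'A; move/compatibleP: O'A => [_ /(_ _ _ tX XO)]; rewrite XA.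
  by case: (s).
have := opposite_not_separated (subtree_neq0 tX) XO XO'; case.
by apply: sepO; rewrite ?setU11 ?setU1r.
Qed.
End Realization.

(** Every subtree is directed, with its own sign, by some compatible orientation, so the signs can
    be read off from the orientations. *)
Lemma compatible_inj (A B : {set {set 'I_N}}) : biclosed A -> biclosed B ->
  (forall X, X \in A -> subtree X) -> (forall X, X \in B -> subtree X) ->
  compatible A = compatible B -> A = B.
Proof.
move=> bA bB subA subB AB; apply/setP => X.
have [tX|nX] := boolP (subtree X); last first.
  by apply/idP/idP => [/subA|/subB]; rewrite (negPf nX).
have [O OA XO] := compatible_contains bA tX.
by rewrite AB in OA; move/compatibleP: OA => [_ /(_ _ _ tX XO)].
Qed.
End Regions.

(** * Biclosed families of subtrees of the fork tree *)

Section ForkTree.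
Variables a b : nat.
Notation N := (a + b + 2).
Implicit Types (i j k : 'I_N) (X : {set 'I_N}).

Lemma fork_parent_subproof (i : 'I_N) : (if i == a + b + 1 :> nat then a else i.-1) < N.
Proof. by have := ltn_ord i; case: eqP => _; lia. Qed.

(** The root is the left end of the path, so the parent of a path triangle is its predecessor, while
    the leaf hangs below triangle [a]. The root is sent to itself. *)
Definition fork_parent i : 'I_N := Ordinal (fork_parent_subproof i).
Notation p := fork_parent.

Lemma fork_parent_lt i : 0 < i -> p i < i.
Proof. by rewrite /=; case: eqP; lia. Qed.

Lemma fork_descE i k : (k \in desc p i) =
  if i == a + b + 1 :> nat then k == i
  else if k == a + b + 1 :> nat then i <= a else i <= k.
Proof.
have [m] := ubnP (val k); elim: m k => // m IH k km.
have [->|ki] := eqVneq k i; first by rewrite desc_refl; case: ifP => [_|->]; rewrite ?eqxx ?leqnn.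
have -> : (k \in desc p i) = (p k < k) && (p k \in desc p i).
  apply/idP/andP => [/desc_parent/(_ ki)//|[pk]]; exact: desc_child.
have [k0|k0] := posnP (val k).
  have -> : (p k < k) = false by rewrite k0.
  by move: ki; rewrite -!(inj_eq val_inj) /= k0; do !case: ifP; lia.
have pk := fork_parent_lt k0; rewrite pk IH; last exact: (leq_trans pk km).
have := ltn_ord i; have := ltn_ord k; move: ki k0.
rewrite -!(inj_eq val_inj) /=; do !case: ifP; lia.
Qed.

(* Triangle [a + b + 1] is the extra leaf; [seg l h e] consists of the path
   triangles [l, ..., h - 1] together with the leaf if [e]. *)
Definition seg (l h : nat) (e : bool) : {set 'I_N} :=
  [set k : 'I_N | if k == a + b + 1 :> nat then e else l <= k < h].

Definition leaf : {set 'I_N} := seg 0 0 true.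

(** The leaf is attached to triangle [a] only, so a segment with the leaf must contain [a]. The lone
    leaf is treated separately as [leaf]. *)
Definition valid (l h : nat) (e : bool) := [&& l < h, h <= a + b + 1 & e ==> (l <= a < h)].

Lemma mem_seg (k : nat) (kN : k < N) l h e :
  (Ordinal kN \in seg l h e) = if k == a + b + 1 then e else l <= k < h.
Proof. by rewrite inE. Qed.

Lemma seg_mem l h e l' h' e' : seg l h e = seg l' h' e' -> forall k : nat, k < N ->
  (if k == a + b + 1 then e else l <= k < h) = (if k == a + b + 1 then e' else l' <= k < h').
Proof. by move=> E k kN; rewrite -!(mem_seg kN) E. Qed.

Lemma seg_inj l h e l' h' e' : valid l h e -> valid l' h' e' ->
  seg l h e = seg l' h' e' -> [/\ l = l', h = h' & e = e'].
Proof.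
case/and3P => lh hN _ /and3P[lh' hN' _] /seg_mem E.
have := E (a + b + 1); rewrite eqxx => ->; last by lia.
have E' (k : nat) : k <= a + b -> (l <= k < h) = (l' <= k < h').
  by move=> kab; have -> : l <= k < h = (if k == a + b + 1 then e else l <= k < h); [case: ifP|rewrite E; [case: ifP|]]; lia.
have := E' l; have := E' l'; have := E' h.-1; have := E' h'.-1 => E1 E2 E3 E4.
have ll : l = l' by lia.
by rewrite ll; suff -> : h = h' by []; lia.
Qed.

Lemma seg_neq_leaf l h e : valid l h e -> seg l h e != leaf.
Proof.
case/and3P => lh hN _; apply/eqP => /seg_mem/(_ l).
by do !case: ifP; lia.
Qed.

Lemma subtree_leaf : subtree p leaf.
Proof.
have mN : a + b + 1 < N by lia.
apply/subtreeP; exists (Ordinal mN); first by rewrite mem_seg eqxx.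
move=> i; rewrite inE; case: eqP => // im _; case/eqP; exact: ord_inj.
Qed.

Lemma subtree_seg l h e : valid l h e -> subtree p (seg l h e).
Proof.
case/and3P => lh hN ee; have lN : l < N by lia.
apply/subtreeP; exists (Ordinal lN); first by rewrite mem_seg; case: ifP; lia.
move=> i; rewrite -(inj_eq val_inj) /= => il ne.
split; move: il ne ee; rewrite !inE /=; do !case: ifP; lia.
Qed.

(** Unless the top is the leaf, let [q] be the last path triangle of [X]: following parents from [q]
    back to the top fills the segment. *)
Lemma subtree_cases X : subtree p X ->
  X = leaf \/ exists l h e, valid l h e /\ X = seg l h e.
Proof.
case/subtree_top => r topr; have rN := ltn_ord r.
have [rm|rm] := eqVneq (r : nat) (a + b + 1).
  left; apply/setP => i; rewrite inE; have [im|im] := eqVneq (i : nat) (a + b + 1).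
    by rewrite (_ : i = r) ?topr.1 //; apply: ord_inj; rewrite im rm.
  rewrite andbF; apply/negbTE/negP => /(top_le topr); have := ltn_ord i; lia.
have [q /andP[qX qm] qmax] : exists2 q, (q \in X) && (q != a + b + 1 :> nat) &
    forall i, (i \in X) && (i != a + b + 1 :> nat) -> i <= q.
  case: (@arg_maxnP _ r [pred i | (i \in X) && (i != a + b + 1 :> nat)] val).
    by rewrite /= topr.1.
  by move=> q qP qmax; exists q.
have down c : forall i, i + c = q -> r <= i -> i \in X.
  elim: c => [i|c IH i ic ri]; first by rewrite addn0 => /ord_inj ->.
  have iN : i.+1 < N by have := ltn_ord q; lia.
  have /(topr.2 (Ordinal iN)) : Ordinal iN \in X by apply: IH => /=; lia.
  case; first by rewrite -(inj_eq val_inj) /=; lia.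
  move=> _; rewrite (_ : p _ = i) //; apply: ord_inj => /=.
  by move: qm; case: ifP => //; have := ltn_ord q; lia.
pose e := [exists i in X, i == a + b + 1 :> nat].
have rq := top_le topr qX; have qN := ltn_ord q.
right; exists r, q.+1, e; split.
  apply/and3P; split=> //; first by lia.
  apply/implyP => /existsP[i /andP[iX im]].
  have /(topr.2 i iX) : i != r by apply: contraNneq rm => <-.
  case=> _ aX; have pa : p i = a :> nat by rewrite /= im.
  have := top_le topr aX; have := qmax (p i); rewrite aX pa /=; lia.
apply/setP => i; rewrite inE; case: ifP => im.
  apply/idP/existsP => [iX|[j /andP[jX jm]]]; first by exists i; rewrite iX.
  by rewrite (_ : i = j) //; apply: ord_inj; rewrite (eqP im) (eqP jm).
apply/idP/andP => [iX|[ri iq]]; last by apply: (down (q - i)) => //; lia.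
by rewrite ltnS qmax ?iX ?im // (top_le topr).
Qed.

Lemma seg_setI l h e i : valid l h e -> l < i < h -> seg l h e :&: desc p i =
  if i <= a then seg i h e else seg i h false.
Proof.
case/and3P => lh hN ee lih; apply/setP => k; rewrite in_setI fork_descE; have := ltn_ord k.
have -> : (i == a + b + 1 :> nat) = false by lia.
by case: (leqP i a) => ia; rewrite !inE; case: ifP; lia.
Qed.

Lemma seg_setD l h e i : valid l h e -> l < i < h -> seg l h e :\: desc p i =
  if i <= a then seg l i false else seg l i e.
Proof.
case/and3P => lh hN ee lih; apply/setP => k; rewrite in_setD fork_descE; have := ltn_ord k.
have -> : (i == a + b + 1 :> nat) = false by lia.
by case: (leqP i a) => ia; rewrite !inE; case: ifP; lia.
Qed.

Lemma leaf_setI l h i : valid l h true -> i = a + b + 1 :> nat ->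
  seg l h true :&: desc p i = leaf.
Proof.
case/and3P => lh hN ee im; apply/setP => k; rewrite in_setI fork_descE -(inj_eq val_inj) /=.
by rewrite im eqxx !inE; case: ifP; lia.
Qed.

Lemma leaf_setD l h i : valid l h true -> i = a + b + 1 :> nat ->
  seg l h true :\: desc p i = seg l h false.
Proof.
case/and3P => lh hN ee im; apply/setP => k; rewrite in_setD fork_descE -(inj_eq val_inj) /=.
by rewrite im eqxx !inE; case: ifP; lia.
Qed.

(** Biclosedness split by the place of the cut: up to the fork the leaf stays with the upper part,
    beyond it with the lower part, and the third clause cuts off the leaf itself, whose sign is
    [eps]. *)
Record fork_closed (sv : nat -> nat -> bool -> bool) (eps : bool) : Prop := ForkClosed {
  fork_closed_low : forall l c h e, valid l h e -> l < c < h -> c <= a ->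
    sv l c false = sv c h e -> sv l h e = sv c h e;
  fork_closed_high : forall l c h e, valid l h e -> l < c < h -> a < c ->
    sv l c e = sv c h false -> sv l h e = sv l c e;
  fork_closed_leaf : forall l h, valid l h true ->
    eps = sv l h false -> sv l h true = eps
}.

Lemma biclosed_fork (A : {set {set 'I_N}}) : biclosed p A <->
  fork_closed (fun l h e => seg l h e \in A) (leaf \in A).
Proof.
split=> [bicA|fcA].
  have mN : a + b + 1 < N by lia.
  split=> [l c h e v lch ca|l c h e v lch ca|l h v] E.
  - have cN : c < N by case/and3P: v; lia.
    have := bicA _ (Ordinal cN) (subtree_seg v).
    rewrite (seg_setI (i := Ordinal cN) v lch) (seg_setD (i := Ordinal cN) v lch) /= ca; apply => //.
    + by rewrite mem_seg; case: ifP; case/and3P: v; lia.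
    + by rewrite inE /=; do !case: ifP; case/and3P: v; lia.
    by case: ifP; lia.
  - have cN : c < N by case/and3P: v; lia.
    have := bicA _ (Ordinal cN) (subtree_seg v).
    rewrite (seg_setI (i := Ordinal cN) v lch) (seg_setD (i := Ordinal cN) v lch) /= [c <= a]leqNgt ca /= E; apply => //.
    + by rewrite mem_seg; case: ifP; case/and3P: v; lia.
    + by rewrite inE /=; do !case: ifP; case/and3P: v; lia.
    by case: ifP; lia.
  have := bicA _ (Ordinal mN) (subtree_seg v).
  rewrite (leaf_setI v) // (leaf_setD v) //; apply => //.
  + by rewrite mem_seg eqxx.
  + by rewrite inE /= eqxx; case: ifP; case/and3P: v; lia.
  by rewrite /= eqxx; lia.
move=> X i /subtree_cases[->|[l [h [e [v ->]]]]].
  rewrite !inE; case: ifP => // im _.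
  by rewrite /= im; case: ifP; lia.
have iN := ltn_ord i; case/and3P: (v) => lh hN /implyP ee.
have [im|im] := eqVneq (i : nat) (a + b + 1).
  rewrite inE im eqxx => et; rewrite et in v *; rewrite (leaf_setI v) // (leaf_setD v) // => _ _.
  exact: (fork_closed_leaf fcA).
move=> iX piX pi; have lih : l < i < h.
  move: iX piX; rewrite !inE /= (negPf im).
  by case: ifP; lia.
rewrite (seg_setI v lih) (seg_setD v lih); case: (leqP i a) => ia E.
  exact: (fork_closed_low fcA).
by rewrite E; apply: (fork_closed_high fcA).
Qed.

(** * Encoding sign functions by permutations and nested chains *)

Definition region_set (sv : nat -> nat -> bool -> bool) (eps : bool) : {set {set 'I_N}} :=
  [set X | (X == leaf) && eps || [exists l : 'I_N, [exists h : 'I_N, [exists e : bool,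
     [&& valid l h e, X == seg l h e & sv l h e]]]]].

Lemma leaf_region_set sv eps : (leaf \in region_set sv eps) = eps.
Proof.
rewrite inE eqxx /=; case: eps => //=; apply/existsP => -[l /existsP[h /existsP[e]]].
by case/and3P => v; rewrite eq_sym (negPf (seg_neq_leaf v)).
Qed.

Lemma seg_region_set sv eps l h e : valid l h e ->
  (seg l h e \in region_set sv eps) = sv l h e.
Proof.
move=> v; rewrite inE (negPf (seg_neq_leaf v)) /=; apply/existsP/idP => [[l' /existsP[h' /existsP[e']]]|s].
  by case/and3P => v' /eqP /(seg_inj v v')[-> -> ->].
have lN : l < N by case/and3P: v; lia.
have hN : h < N by case/and3P: v; lia.
exists (Ordinal lN); apply/existsP; exists (Ordinal hN); apply/existsP; exists e.
by rewrite /= v eqxx s.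
Qed.

Lemma region_set_subtree sv eps X : X \in region_set sv eps -> subtree p X.
Proof.
rewrite inE => /orP[/andP[/eqP -> _]|]; first exact: subtree_leaf.
by case/existsP => l /existsP[h /existsP[e /and3P[v /eqP -> _]]]; exact: subtree_seg.
Qed.

Lemma eq_region_set (A B : {set {set 'I_N}}) :
  (forall X, X \in A -> subtree p X) -> (forall X, X \in B -> subtree p X) ->
  (leaf \in A) = (leaf \in B) ->
  (forall l h e, valid l h e -> (seg l h e \in A) = (seg l h e \in B)) -> A = B.
Proof.
move=> sA sB leafAB segAB; apply/setP => X.
have [/subtree_cases[->//|[l [h [e [v ->]]]]]|nX] := boolP (subtree p X); first exact: segAB.
by apply/idP/idP => [/sA|/sB]; rewrite (negPf nX).
Qed.

Lemma region_set_biclosed sv eps : fork_closed sv eps -> biclosed p (region_set sv eps).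
Proof.
move=> fc; apply/biclosed_fork; split.
- move=> l c h e v lch ca; rewrite !seg_region_set //; first exact: (fork_closed_low fc).
    by move: v lch ca; rewrite /valid; case: e; lia.
  by move: v lch ca; rewrite /valid; case: e; lia.
- move=> l c h e v lch ca; rewrite !seg_region_set //; first exact: (fork_closed_high fc).
    by move: v lch ca; rewrite /valid; case: e; lia.
  by move: v lch ca; rewrite /valid; case: e; lia.
move=> l h v; rewrite leaf_region_set !seg_region_set //; first exact: (fork_closed_leaf fc).
by move: v; rewrite /valid; lia.
Qed.

(* The gaps [0, ..., a + b + 1] between consecutive path triangles are ordered by
   [g] on the left of the fork and, reversed, by [f] on the right; [t] records
   for each right gap how many left gaps precede it, without and with the leaf
   (the larger count being the one with the leaf iff the sign [eps] of the leaf
   is positive). *)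
Definition code_value (eps : bool) (g : 'S_a.+1) (f : 'S_b.+1)
    (t : b.+1.-tuple ('I_a.+2 * 'I_a.+2)) (l h : nat) (e : bool) :=
  if h <= a then g (inord l) < g (inord h)
  else if a < l then f (inord (h - a.+1)) < f (inord (l - a.+1))
  else let w := tnth t (f (inord (h - a.+1))) in g (inord l) < (if e == eps then w.2 else w.1).

(** All signs are comparisons of ranks and thresholds. Cuts on the left follow by transitivity, cuts
    on the right because the thresholds decrease with the rank of the right gap, and the cut at the
    leaf because the two thresholds are nested. *)
Lemma code_fork_closed eps g f (t : b.+1.-tuple ('I_a.+2 * 'I_a.+2)) : path (@below a.+1) (ord_max, ord_max) t ->
  fork_closed (code_value eps g f t) eps.
Proof.
case/chain_heightsP => le1 le2.
have mono (e : bool) (y y' : 'I_b.+1) : y <= y' ->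
    (if e then (tnth t y').2 else (tnth t y').1) <= (if e then (tnth t y).2 else (tnth t y).1).
  by rewrite leq_eqVlt => /orP[/eqP/ord_inj ->//|/le2[? ?]]; case: e.
split=> [l c h e|l c h e|l h].
- case/and3P => lh hN ee lch ca; rewrite /code_value ca.
  have -> : a < l = false by lia.
  have -> : a < c = false by lia.
  by case: ifP => ha; lia.
- case/and3P => lh hN ee lch ac; rewrite /code_value [c <= a]leqNgt ac /=.
  have -> : h <= a = false by lia.
  case: ifP => al; first by lia.
  have := mono (e == eps) (f (inord (c - a.+1))) (f (inord (h - a.+1))).
  have := mono (e == eps) (f (inord (h - a.+1))) (f (inord (c - a.+1))).
  by lia.
case/and3P => lh hN ee; rewrite /code_value.
have -> : h <= a = false by lia.
have -> : a < l = false by lia.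
by have := le1 (f (inord (h - a.+1))); case: eps => /=; lia.
Qed.

(** Segments left of the fork determine [g], those right of it determine [f], and segments across it
    recover each threshold from the left gaps below it. *)
Lemma code_value_inj eps g f t g' f' t' :
  (forall l h e, valid l h e -> code_value eps g f t l h e = code_value eps g' f' t' l h e) ->
  [/\ g = g', f = f' & t = t'].
Proof.
move=> E.
have gg : g = g'.
  apply: perm_order_inj => i j ij; have ia := ltn_ord i; have ja := ltn_ord j.
  have := E i j false; rewrite /code_value -ltnS ja !inord_val; apply.
  by rewrite /valid; lia.
have ff : f = f'.
  apply: perm_order_inj => i j ij; have ia := ltn_ord i; have ja := ltn_ord j.
  have ne : i != j by rewrite -(inj_eq val_inj) /=; lia.
  have := E (i + a.+1) (j + a.+1) false; rewrite /code_value.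
  have -> : j + a.+1 <= a = false by lia.
  have -> : a < i + a.+1 by lia.
  rewrite !addnK !inord_val (perm_ltn_flip f ne) (perm_ltn_flip f' ne) => -> //.
  by rewrite /valid; lia.
split=> //; rewrite -gg -ff in E.
have heq e y : (if e == eps then (tnth t y).2 else (tnth t y).1)
             = (if e == eps then (tnth t' y).2 else (tnth t' y).1).
  apply: ltn_all_eq => x; pose l := perm_inv g x; pose h := perm_inv f y.
  have la := ltn_ord l; have hb := ltn_ord h.
  have := E l (h + a.+1) e; rewrite /code_value.
  have -> : h + a.+1 <= a = false by lia.
  have -> : a < l = false by lia.
  rewrite addnK !inord_val /l /h !permKV; apply; rewrite /valid -/l -/h.
  by case: e; lia.
apply: eq_from_tnth => y; have := heq eps y; have := heq (~~ eps) y.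
by case: eps {E heq}; case: (tnth t y) (tnth t' y) => [? ?] [? ?] /= -> ->.
Qed.

(** In the ranks given by [g] and [f], the positive segments across the fork form a Young diagram
    for each [e], by the two cut conditions; its column heights are the thresholds. *)
Lemma fork_closed_code sv eps : fork_closed sv eps ->
  exists g f (t : b.+1.-tuple ('I_a.+2 * 'I_a.+2)),
    path (@below a.+1) (ord_max, ord_max) t /\
    forall l h e, valid l h e -> code_value eps g f t l h e = sv l h e.
Proof.
move=> fc.
have [|g gE] := @perm_of_triples a.+1 (fun x y => sv x y false).
  move=> x y z xy yz sxyz; have := ltn_ord z => za; rewrite sxyz.
  by apply: (fork_closed_low fc) sxyz; rewrite /valid; lia.
(* The sign is negated because [code_value] compares right gaps in reverse. *)
have [|f fE] := @perm_of_triples b.+1 (fun x y => ~~ sv (x + a.+1) (y + a.+1) false).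
  move=> x y z xy yz /negb_inj sxyz; have := ltn_ord z => za; congr (~~ _).
  by apply: (fork_closed_high fc) sxyz; rewrite /valid; lia.
pose M e x y := sv (perm_inv g x) (perm_inv f y + a.+1) e.
have vM e x y : valid (perm_inv g x) (perm_inv f y + a.+1) e.
  have := ltn_ord (perm_inv g x); have := ltn_ord (perm_inv f y).
  by rewrite /valid; case: e; lia.
have Mx e y (x x' : 'I_a.+1) : x <= x' -> M e x' y -> M e x y.
  rewrite leq_eqVlt => /orP[/eqP/ord_inj -> //|].
  rewrite -{1}(permKV g x) -{1}(permKV g x') /M.
  have := vM e x y; have := vM e x' y.
  set l := perm_inv g x; set l' := perm_inv g x'; set h := (_ + _)%N => v' v.
  have := ltn_ord l; have := ltn_ord l' => l'a la.
  have [ll|ll|/ord_inj ->] := ltngtP l l'; last by rewrite ltnn.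
    rewrite (gE _ _ ll) => s1 s2.
    by rewrite (fork_closed_low fc v (c := l')) //; [move: v'; rewrite /valid; lia|rewrite s1 s2].
  rewrite perm_ltn_flip -?(inj_eq val_inj) /= ?gtn_eqF // (gE _ _ ll) => /negbTE s1 s2.
  apply: contraLR s2 => /negbTE s2.
  by rewrite (fork_closed_low fc v' (c := l)) //; [rewrite s2|move: v; rewrite /valid; lia|rewrite s1 s2].
have My e x (y y' : 'I_b.+1) : y <= y' -> M e x y' -> M e x y.
  rewrite leq_eqVlt => /orP[/eqP/ord_inj -> //|].
  rewrite -{1}(permKV f y) -{1}(permKV f y') /M.
  have := vM e x y; have := vM e x y'.
  set h := perm_inv f y; set h' := perm_inv f y'; set l := perm_inv g x => v' v.
  have := ltn_ord l; have := ltn_ord h; have := ltn_ord h' => h'b hb la.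
  have [hh|hh|/ord_inj ->] := ltngtP h h'; last by rewrite ltnn.
    rewrite (fE _ _ hh) => /negbTE s1 s2.
    apply: contraLR s2 => /negbTE s2.
    by rewrite (fork_closed_high fc v' (c := h + a.+1)) ?s2 ?s1 //; lia.
  rewrite perm_ltn_flip -?(inj_eq val_inj) /= ?gtn_eqF // (fE _ _ hh) negbK => s1 s2.
  by rewrite (fork_closed_high fc v (c := h' + a.+1)) ?s2 ?s1 //; lia.
pose cnt e y := #|[pred x | M e x y]|.
have cnta e y : cnt e y < a.+2.
  by rewrite ltnS -[X in _ <= X](card_ord a.+1); exact: max_card.
have cntE e x y : M e x y = (x < cnt e y).
  by rewrite -(downset_card (P := [pred x | M e x y])) // => i j ij; exact: Mx.
(* The smaller diagram comes first: adding the leaf can only enlarge the diagram when the leaf is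
   positive and only shrink it otherwise. *)
pose t := [tuple (Ordinal (cnta (~~ eps) y), Ordinal (cnta eps y)) | y < b.+1].
exists g, f, t; split.
  apply/chain_heightsP; split=> [y|y y' yy']; rewrite !tnth_mktuple /=.
    apply/subset_leq_card/subsetP => x; rewrite !inE /M => Mt.
    have v1 := vM true x y; have := fork_closed_leaf fc v1.
    by move: Mt; case: (eps) => /=; do 2!case: (sv _ _ _) => //; move=> _ /(_ erefl).
  by split; apply/subset_leq_card/subsetP => x; rewrite !inE; apply: My; exact: ltnW.
move=> l h e; rewrite /code_value; case/and3P => lh hN ee.
have [ha|ah] := leqP h a.
  have -> : e = false by case: e ee; lia.
  by rewrite gE !inordK //; lia.
have [al|la] := ltnP a l.
  have -> : e = false by case: e ee; lia.
  have hl : (inord (l - a.+1) : 'I_b.+1) < (inord (h - a.+1) : 'I_b.+1) by rewrite !inordK //; lia.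
  rewrite perm_ltn_flip -?(inj_eq val_inj) /= ?gtn_eqF // (fE _ _ hl) negbK.
  by rewrite !inordK ?subnK //; lia.
rewrite tnth_mktuple /=; transitivity (M e (g (inord l)) (f (inord (h - a.+1)))).
  by rewrite cntE; case: eqP => [->|/eqP]; rewrite // eq_sym negb_eqb => /addbP ->.
by rewrite /M !permK !inordK ?subnK //; lia.
Qed.

Lemma fork_biclosed_count : exists L : seq {set {set 'I_N}},
  [/\ uniq L,
      forall A, A \in L <-> biclosed p A /\ forall X, X \in A -> subtree p X &
      size L = 2 * (N + 1) * (N`! %/ (N - a)`!) * (N`! %/ (N - b)`!)].
Proof.
pose code := (bool * 'S_a.+1 * 'S_b.+1 * b.+1.-tuple ('I_a.+2 * 'I_a.+2))%type.
pose region (q : code) := region_set (code_value q.1.1.1 q.1.1.2 q.1.2 q.2) q.1.1.1.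
pose ok := setX [set: bool * 'S_a.+1 * 'S_b.+1]
  [set t : b.+1.-tuple ('I_a.+2 * 'I_a.+2) | path (@below a.+1) (ord_max, ord_max) t].
exists [seq region q | q <- enum ok]; split.
- rewrite map_inj_uniq ?enum_uniq // => -[[[eps g] f] t] [[[eps' g'] f'] t'] /= E.
  have ee : eps = eps'.
    by rewrite -[eps](leaf_region_set (code_value eps g f t)) [region_set _ _]E leaf_region_set.
  subst eps'; have [l h e v|-> -> ->] // := @code_value_inj eps g f t g' f' t'.
  by rewrite -(seg_region_set _ eps v) [region_set _ _]E seg_region_set.
- move=> A; split=> [/mapP[[[[eps g] f] t] + ->]|[bA sA]].
    rewrite mem_enum !inE /= => tP; split; last exact: region_set_subtree.
    exact/region_set_biclosed/code_fork_closed.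
  have /fork_closed_code[g [f [t [tP E]]]] := (biclosed_fork A).1 bA.
  apply/mapP; exists ((leaf \in A, g, f), t); first by rewrite mem_enum !inE.
  apply: eq_region_set => //; first exact: region_set_subtree.
    by rewrite leaf_region_set.
  by move=> l h e v; rewrite seg_region_set //= E.
(* The number of codes is [2 (a + 1)! (b + 1)!] times the number of chains for [p = a + 1] and
   [q = b + 1], where [p + q = N]. *)
rewrite size_map -cardE cardsX cardsT !card_prod card_bool !card_Sn -!ffact_factd; try lia.
have := num_chains_top a.+1 b.+1; rewrite /num_chains.
set c := #|_|; have -> : a.+1 + b.+1 = N by lia.
have := @ffact_fact N a; have := @ffact_fact N b.
have [-> ->] : N - a = b.+2 /\ N - b = a.+2 by lia.
move=> /(_ ltac:(lia)) fb /(_ ltac:(lia)) fa E.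
(* The factor [(a + 2)! (b + 2)!] is [(N - b)! (N - a)!] and clears both quotients. *)
apply/eqP; rewrite -(@eqn_pmul2r (a.+2`! * b.+2`!)) ?muln_gt0 ?fact_gt0 //; apply/eqP.
transitivity (2 * (c * (a.+1`! * b.+1`!) * (a.+2`! * b.+2`!))); first by ring.
rewrite E factS -{1}fa -{1}fb; ring.
Qed.
End ForkTree.

(** * Triangulated polygons *)

Section PolygonTriangulation.
Variables (n : nat) (D : {set 'I_n.+2 * 'I_n.+2}).
Hypothesis trD : triangulation D.
Notation V := 'I_n.+2.
Implicit Types (x y z u v w : V) (t : {set V}).

Definition cyclic_triple x y z := [|| x < y < z, y < z < x | z < x < y].

Definition ccw_arc t x y := [&& x \in t, y \in t & [exists z in t, cyclic_triple x y z]].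

Lemma gedge_in x y : gedge D x y -> x < y -> ~~ side x y -> (x, y) \in D.
Proof.
case/or3P => [->//|//|/(let: And3 H _ _ := trD in H)].
by rewrite /is_diag /= => /andP[yx _]; lia.
Qed.

Lemma gedge_noncrossing x y z w : gedge D x z -> gedge D y w ->
  x < y -> y < z -> z < w -> False.
Proof.
move=> xz yw lxy lyz lzw; have [_ _ nc] := trD; have wn := ltn_ord w.
have xzD : (x, z) \in D by apply: gedge_in => //; rewrite ?/side /=; lia.
have ywD : (y, w) \in D by apply: gedge_in => //; rewrite ?/side /=; lia.
by have := nc _ _ xzD ywD; rewrite /crossing /= lxy lyz lzw.
Qed.

Lemma cyclic_noncrossing x y z w : cyclic_triple x y z -> cyclic_triple x z w ->
  gedge D x z -> gedge D y w -> False.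
Proof.
move=> c1 c2 xz yw; have zx := xz; have wy := yw; rewrite gedge_sym in zx; rewrite gedge_sym in wy.
case/or3P: c1 => /andP[l1 l2]; case/or3P: c2 => /andP[l3 l4]; try lia.
- exact: (gedge_noncrossing xz yw).
- by apply: (gedge_noncrossing wy xz).
- by apply: (gedge_noncrossing yw zx).
by apply: (gedge_noncrossing zx wy).
Qed.

Lemma triangle_edge t x y : triangle D t -> x \in t -> y \in t -> x != y -> gedge D x y.
Proof. by case/andP => _ /forall_inP H /H/forall_inP H1 /H1/implyP. Qed.

Lemma triangleP t : triangle D t -> exists x y z, [/\ uniq [:: x; y; z],
  t =i [:: x; y; z] & cyclic_triple x y z].
Proof.
case/andP; rewrite cardE => sz _; have := enum_uniq t; have tE := mem_enum t.
case: (enum t) sz tE => [|x [|y [|z []]]] // _ tE xyz.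
have [c|nc] := boolP (cyclic_triple x y z).
  by exists x, y, z; split=> // w; rewrite -tE.
exists y, x, z; split=> [|w|].
- by move: xyz; rewrite /= !inE [y == x]eq_sym !negb_or -!andbA; case/and4P=> -> -> -> .
- by rewrite -tE !inE orbCA.
move: xyz nc; rewrite /= !inE -!(inj_eq val_inj) /cyclic_triple /=; lia.
Qed.

Lemma ccw_arcP t x y : triangle D t -> ccw_arc t x y ->
  exists z, [/\ uniq [:: x; y; z], t =i [:: x; y; z], cyclic_triple x y z &
    forall u w, ccw_arc t u w = ((u, w) \in [:: (x, y); (y, z); (z, x)])].
Proof.
move=> /andP[/eqP t3 _] /and3P[xt yt /existsP[z /andP[zt c]]].
have xyz : uniq [:: x; y; z].
  by move: c; rewrite /cyclic_triple /= !inE -!(inj_eq val_inj) /=; lia.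
have tE : t =i [:: x; y; z].
  have sub : [set w in [:: x; y; z]] \subset t.
    by apply/subsetP => w; rewrite !inE => /or3P[] /eqP ->.
  have := subset_leqif_cards sub; rewrite cardsE (card_uniqP xyz) t3 => -[_].
  by rewrite eqxx => /esym/eqP <- w; rewrite inE.
exists z; split=> // u w; apply/idP/idP; last first.
  rewrite !inE => /or3P[] /eqP[-> ->]; apply/and3P; split=> //; apply/existsP.
  - by exists z; rewrite zt.
  - by exists x; rewrite xt; move: c; rewrite /cyclic_triple; lia.
  by exists y; rewrite yt; move: c; rewrite /cyclic_triple; lia.
case/and3P; rewrite !tE !inE => ut wt /existsP[v /andP[]]; rewrite tE !inE => vt.
move: c; rewrite !xpair_eqE.
case/or3P: ut => /eqP ->; case/or3P: wt => /eqP ->; rewrite ?eqxx ?orbT //;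
  case/or3P: vt => /eqP ->; rewrite /cyclic_triple -!(inj_eq val_inj) /=; lia.
Qed.

Lemma ccw_arc_orient t x y : triangle D t -> x \in t -> y \in t -> x != y ->
  ccw_arc t x y || ccw_arc t y x.
Proof.
case/triangleP => a [b [c [abc tE cy]]]; rewrite /ccw_arc => xt yt.
rewrite xt yt /= => xy; suff [z zt czz] : exists2 z, z \in t & cyclic_triple x y z || cyclic_triple y x z.
  by case/orP: czz => czz; apply/orP; [left|right]; apply/existsP; exists z; rewrite zt.
have [ta tb tc] : [/\ a \in t, b \in t & c \in t] by rewrite !tE !inE !eqxx !orbT.
move: xt yt xy; rewrite !tE !inE /cyclic_triple.
case/or3P => /eqP ->; case/or3P => /eqP ->; rewrite ?eqxx // => _;
  [exists c|exists b|exists c|exists a|exists b|exists a] => //;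
  by move: cy; rewrite /cyclic_triple; lia.
Qed.

(** Two different third vertices on the same side of the edge would make an edge of one triangle
    cross an edge of the other. *)
Lemma ccw_arc_uniq t t' x y : triangle D t -> triangle D t' ->
  ccw_arc t x y -> ccw_arc t' x y -> t = t'.
Proof.
move=> tt tt' a a'; have [z [u tE c _]] := ccw_arcP tt a.
have [z' [u' tE' c' _]] := ccw_arcP tt' a'.
have [zz|zz] := eqVneq z z'; first by apply/setP => w; rewrite tE tE' zz.
have gt v w : v \in t -> w \in t -> v != w -> gedge D v w by exact: triangle_edge.
have gt' v w : v \in t' -> w \in t' -> v != w -> gedge D v w by exact: triangle_edge.
have [xz yz] : x != z /\ y != z by move: u; rewrite /= !inE negb_or; case/and3P => /andP[].
have [xz' yz'] : x != z' /\ y != z' by move: u'; rewrite /= !inE negb_or; case/and3P => /andP[].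
exfalso; have : cyclic_triple x z z' \/ cyclic_triple x z' z.
  by move: c c' zz; rewrite /cyclic_triple -(inj_eq val_inj) /=; lia.
case=> cc.
  apply: (cyclic_noncrossing c cc); first by apply: gt; rewrite // tE !inE eqxx ?orbT.
  by apply: gt'; rewrite // tE' !inE eqxx ?orbT.
apply: (cyclic_noncrossing c' cc); first by apply: gt'; rewrite // tE' !inE eqxx ?orbT.
by apply: gt; rewrite // tE !inE eqxx ?orbT.
Qed.

Definition ccw_side x y := (y == x.+1 :> nat) || (x == n.+1 :> nat) && (y == 0 :> nat).

(* The arcs which can be counterclockwise in a triangle: there are at most [3 n]
   of them, so [n] triangles use them all and every edge lies in a triangle. *)
Definition allowed_arcs : {set V * V} :=
  [set e : V * V | ccw_side e.1 e.2] :|: (D :|: [set e : V * V | (e.2, e.1) \in D]).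

(** The [n + 2] sides count in one direction and the [n - 1] diagonals in both. *)
Lemma card_allowed_arcs : 0 < n -> #|allowed_arcs| <= 3 * n.
Proof.
move=> n0.
have cD : #|D| = n.-1 by case: trD.
have cD' : #|[set e : V * V | (e.2, e.1) \in D]| <= n.-1.
  have swap_inj : injective (fun e : V * V => (e.2, e.1)) by move=> [? ?] [? ?] [-> ->].
  rewrite -cD -(card_imset D swap_inj); apply: subset_leq_card.
  apply/subsetP => -[x y]; rewrite inE /= => yxD; apply/imsetP; by exists (y, x).
have cN : #|[set e : V * V | ccw_side e.1 e.2]| <= n.+2.
  rewrite -[X in _ <= X](card_ord n.+2) -(card_in_imset (f := fst)).
    exact: max_card.
  move=> [x y] [x' y']; rewrite !inE /ccw_side /= => h h' E; subst x'; congr pair.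
  by apply: ord_inj; have := ltn_ord y; have := ltn_ord y'; lia.
rewrite /allowed_arcs; set A := [set e | ccw_side _ _] in cN *; set B := [set e | _] in cD' *.
have [h1 _] := leq_card_setU A (D :|: B); have [h2 _] := leq_card_setU D B.
apply: leq_trans h1 _; apply: leq_trans (leq_add cN (leq_trans h2 (leq_add (leqnn _) cD'))) _.
by rewrite cD; lia.
Qed.

Lemma ccw_arc_allowed t x y : triangle D t -> ccw_arc t x y -> (x, y) \in allowed_arcs.
Proof.
move=> tt a; have [z [u tE c _]] := ccw_arcP tt a.
have xy : x != y by move: u; rewrite /= !inE negb_or; case/and3P => /andP[].
have : gedge D x y by apply: (triangle_edge tt) => //; rewrite tE !inE eqxx ?orbT.
rewrite /gedge !inE /=; case/or3P => [|->|->]; rewrite ?orbT //.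
move: c; rewrite /side /cyclic_triple /ccw_side /= => c s; apply/orP; left; have := ltn_ord z; lia.
Qed.

Lemma allowed_arcs_both x y : 2 <= n -> (x, y) \in allowed_arcs -> (y, x) \in allowed_arcs ->
  ((x, y) \in D) || ((y, x) \in D).
Proof.
move=> n2; rewrite !inE /= => /or3P[h1|->|->]; rewrite ?orbT // => /or3P[h2|->|->]; rewrite ?orbT //.
by move: h1 h2; rewrite /ccw_side; lia.
Qed.

End PolygonTriangulation.

(** * Triangulations whose dual tree is the fork *)

Section DualFork.
Variables (a b : nat).
Notation N := (a + b + 2).
Notation V := 'I_N.+2.
Variables (D : {set V * V}) (f : 'I_N -> {set V}).
Hypothesis trD : triangulation D.
Hypothesis f_inj : injective f.
Hypothesis f_tri : forall i, triangle D (f i).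
Hypothesis f_adj : forall i j : 'I_N, Tab_adj i j = dual_adj D (f i) (f j).
Implicit Types (i j k : 'I_N) (x y z u v w : V).
Notation p := (@fork_parent a b).
Definition fork_arc i : rel V := ccw_arc (f i).

Let n2 : 2 <= N. Proof. lia. Qed.

Lemma fork_arc_uniq i j x y : fork_arc i x y -> fork_arc j x y -> i = j.
Proof. by move=> h1 h2; apply: f_inj; apply: (ccw_arc_uniq trD) h1 h2. Qed.

Lemma fork_arcP i x y : fork_arc i x y -> exists z, [/\ uniq [:: x; y; z],
  f i =i [:: x; y; z] & forall u w, fork_arc i u w = ((u, w) \in [:: (x, y); (y, z); (z, x)])].
Proof. by case/(ccw_arcP (f_tri i)) => z [? ? _ ?]; exists z. Qed.

Lemma fork_arc_triangle i : exists x y, fork_arc i x y.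
Proof.
have [x [y [z [u tE c]]]] := triangleP (f_tri i); exists x, y.
by rewrite /fork_arc /ccw_arc !tE !inE !eqxx orbT /=; apply/existsP; exists z; rewrite tE !inE eqxx !orbT.
Qed.

(** Equality follows from inclusion by counting: the [N] triangles have three arcs each, no arc
    belongs to two of them, and at most [3 N] arcs are allowed. *)
Lemma fork_arcs_all : [set e : V * V | [exists i, fork_arc i e.1 e.2]] = allowed_arcs D.
Proof.
apply/eqP; rewrite eqEcard; apply/andP; split.
  apply/subsetP => -[x y]; rewrite inE /= => /existsP[i].
  exact: (ccw_arc_allowed (f_tri i)).
apply: leq_trans (card_allowed_arcs trD (ltnW n2)) _.
have -> : 3 * N = \sum_i \sum_(e : V * V) (fork_arc i e.1 e.2 : nat).
  transitivity (\sum_(i : 'I_N) 3); first by rewrite sum_nat_const card_ord mulnC.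
  apply: eq_bigr => i _.
  have [x [y xy]] := fork_arc_triangle i; have [z [u tE E]] := fork_arcP xy.
  have eu : uniq [:: (x, y); (y, z); (z, x)].
    by move: u; rewrite /= !inE !xpair_eqE !negb_or -!andbA => /and4P[h1 h2 h3 _];
       rewrite (negPf h1) (negPf h2) (negPf h3).
  rewrite (eq_bigr (fun e : V * V => (e \in [:: (x, y); (y, z); (z, x)]) : nat)); last first.
    by move=> [v w] _; rewrite /= E.
  by rewrite -big_mkcond /= sum1_card (card_uniqP eu).
rewrite exchange_big /= -sum1_card [X in _ <= X]big_mkcond /=; apply: leq_sum => e _.
rewrite inE; case: ifP => [/existsP[i ie]|/negbT/existsPn ne].
  rewrite (bigD1 i) //= ie big1 // => j ji; apply/eqP; rewrite eqb0.
  by apply: contraNN ji => /fork_arc_uniq/(_ ie) ->.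
by rewrite big1 // => i _; apply/eqP; rewrite eqb0.
Qed.

Lemma fork_gedge x y : gedge D x y = [exists i, fork_arc i x y || fork_arc i y x].
Proof.
apply/idP/existsP => [xy|[i /orP[]]]; last first.
- move=> yx; rewrite gedge_sym; have [z [u tE _]] := fork_arcP yx.
  apply: (triangle_edge (f_tri i)); rewrite ?tE ?inE ?eqxx ?orbT //.
  by move: u; rewrite /= !inE negb_or => /andP[/andP[]].
- move=> xy; have [z [u tE _]] := fork_arcP xy.
  apply: (triangle_edge (f_tri i)); rewrite ?tE ?inE ?eqxx ?orbT //.
  by move: u; rewrite /= !inE negb_or => /andP[/andP[]].
have : ((x, y) \in allowed_arcs D) || ((y, x) \in allowed_arcs D).
  rewrite !inE /=; case/or3P: xy => [|->|->]; rewrite ?orbT //.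
  move=> s; suff /orP[->|->] : ccw_side x y || ccw_side y x by rewrite ?orbT.
  by move: s; rewrite /side /ccw_side /=; lia.
by rewrite -fork_arcs_all !inE /= => /orP[] /existsP[i ixy]; exists i; rewrite ixy ?orbT.
Qed.

(** Two triangles on a common edge traverse it in opposite directions, since a shared arc would
    identify them; conversely, an edge used in both directions cannot be a side and is a
    diagonal. *)
Lemma fork_adjP i j : i != j ->
  reflect (exists x y, fork_arc i x y /\ fork_arc j y x) (Tab_adj i j).
Proof.
move=> ij; rewrite f_adj; have fij : f i != f j by rewrite (inj_eq f_inj).
apply: (iffP andP) => [[_ /existsP[[x y] /= /andP[xyD /and4P[xi yi xj yj]]]]|[x [y [xy yx]]]].
  have xny : x != y.
    by have [/(_ _ xyD)/andP[/= xy _] _ _] := trD; rewrite -(inj_eq val_inj) /= ltn_eqF.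
  have := ccw_arc_orient (f_tri i) xi yi xny; have := ccw_arc_orient (f_tri j) xj yj xny.
  rewrite -/(fork_arc _ _ _) => /orP[] h1 /orP[] h2; [|by exists y, x|by exists x, y|];
  by have ji := fork_arc_uniq h1 h2; rewrite ji eqxx in ij.
split=> //; have [z [_ iE _]] := fork_arcP xy; have [z' [_ jE _]] := fork_arcP yx.
have : ((x, y) \in D) || ((y, x) \in D).
  apply: (allowed_arcs_both n2); rewrite -fork_arcs_all inE /=; apply/existsP; [by exists i|by exists j].
by case/orP => h; apply/existsP; [exists (x, y)|exists (y, x)]; rewrite h /= !iE !jE !inE !eqxx !orbT.
Qed.

Lemma fork_parent_adj i j x y : fork_arc i x y -> fork_arc j y x -> i < j -> i = p j.
Proof.
move=> xy yx ij; have ne : i != j by rewrite -(inj_eq val_inj) ltn_eqF.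
have /fork_adjP-/(_ ne) : exists x y, fork_arc i x y /\ fork_arc j y x by exists x, y.
have := ltn_ord i; have := ltn_ord j; rewrite /Tab_adj => jN iN A; apply: ord_inj => /=.
by move: A; case: ifP => /=; lia.
Qed.

Lemma fork_parent_edge i : p i < i -> exists x y, fork_arc i x y /\ fork_arc (p i) y x.
Proof.
move=> pi; have ne : i != p i by rewrite -(inj_eq val_inj) gtn_eqF.
apply/(fork_adjP ne); have := ltn_ord i; move: pi; rewrite /Tab_adj /=.
by case: ifP; lia.
Qed.

Lemma fork_arc_in i x y : fork_arc i x y -> (x \in f i) && (y \in f i).
Proof. by case/and3P => -> ->. Qed.

(** The first triangle has three vertices and each later one adds at most one, as it shares an edge
    with its parent; reaching all [N + 2] vertices requires each later triangle to add exactly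
    one. *)
Lemma fork_new_vertex i : exists2 v, exists y, fork_arc i v y &
  forall j, j < i -> forall y, ~~ fork_arc j v y.
Proof.
pose W (k : nat) := [set x | [exists j : 'I_N, (j < k) && (x \in f j)]].
have WS (k : nat) (kN : k < N) : W k.+1 = W k :|: f (Ordinal kN).
  apply/setP => x; rewrite !inE; apply/existsP/orP => [[j /andP[]]|[/existsP[j /andP[jk xj]]|xk]].
  - rewrite ltnS leq_eqVlt => /orP[/eqP jk|jk] xj; last by left; apply/existsP; exists j; rewrite jk.
    by right; rewrite (_ : Ordinal kN = j) //; apply: ord_inj.
  - by exists j; rewrite ltnS ltnW.
  by exists (Ordinal kN); rewrite ltnSn.
have card3 j : #|f j| = 3 by have /andP[/eqP] := f_tri j.
have W1 : #|W 1| <= 3.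
  have N0 : 0 < N by lia.
  rewrite (WS 0 N0) -(card3 (Ordinal N0)); apply: subset_leq_card; apply/subsetP => x.
  by rewrite !inE => /orP[/existsP[]|].
have WSle (k : nat) : 0 < k -> k < N -> #|W k.+1| <= #|W k|.+1.
  move=> k0 kN; rewrite (WS k kN); set K := Ordinal kN.
  have pk : p K < K by exact: fork_parent_lt.
  have [x [y [xy yx]]] := fork_parent_edge pk.
  have [z [u _ _]] := fork_arcP xy.
  have xny : x != y by move: u; rewrite /= !inE negb_or; case/and3P => /andP[].
  have : #|[set x; y]| <= #|W k :&: f K|.
    apply: subset_leq_card; apply/subsetP => t.
    have /andP[xK yK] := fork_arc_in xy; have /andP[yp xp] := fork_arc_in yx.
    rewrite !inE => /orP[] /eqP ->; rewrite ?xK ?yK andbT; apply/existsP; exists (p K).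
      by rewrite pk.
    by rewrite pk.
  by rewrite cards2 xny => h; rewrite -(leq_add2r #|W k :&: f K|) cardsUI card3 addSnnS leq_add2l ltnS.
have Wle (k m : nat) : 0 < k -> k + m <= N -> #|W (k + m)| <= #|W k| + m.
  move=> k0; elim: m => [|m IH]; rewrite ?addn0 // addnS => kmN.
  have kmN' : k + m <= N by exact: ltnW.
  by have := WSle (k + m) ltac:(lia) kmN; have := IH kmN'; lia.
have WN : #|W N| = N.+2.
  rewrite -[RHS](card_ord N.+2) -cardsT; congr #|pred_of_set _|; apply/setP => x; rewrite !inE.
  have [y xy] : exists y, gedge D x y.
    have [xn|xn] := ltnP x N.+1.
      by exists (Ordinal (xn : x.+1 < N.+2)); rewrite /gedge /side /= eqxx.
    exists ord0; rewrite /gedge /side /=; have := ltn_ord x; lia.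
  move: xy; rewrite fork_gedge => /existsP[j /orP[] /fork_arc_in/andP[h1 h2]];
  by apply/existsP; exists j; rewrite ltn_ord ?h1 ?h2.
have : ~~ (f i \subset W i).
  apply/negP => fiW; have iN := ltn_ord i.
  have Wi : W i.+1 = W i.
    rewrite (WS i iN) (_ : Ordinal iN = i); last exact: ord_inj.
    exact/setUidPl.
  have [i0|i0] := posnP (i : nat).
    have [x [y /fork_arc_in/andP[/(subsetP fiW)]]] := fork_arc_triangle i.
    by rewrite inE => /existsP[j /andP[]]; rewrite i0.
  have := Wle 1 i.-1 isT; have := Wle i.+1 (N - i.+1) isT.
  rewrite add1n prednK // subnKC // Wi WN => h1 h2.
  have {}h1 := h1 (leqnn _); have {}h2 := h2 (ltnW iN); move: W1 h1 h2.
  by move: #|W 1| #|W i| => c1 ci; lia.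
case/subsetPn => v vi; rewrite inE => /existsPn nv; exists v; last first.
  move=> j ji y; apply: contraNN (nv j) => /fork_arc_in/andP[-> _].
  by rewrite ji.
have [x [y xy]] := fork_arc_triangle i; have [z [_ tE E]] := fork_arcP xy.
by move: vi; rewrite tE !inE => /or3P[] /eqP ->; [exists y|exists z|exists x]; rewrite E !inE !eqxx ?orbT.
Qed.

(** For a triangle other than the root, the edge to the parent serves. The root has three edges but
    at most two children, the triangles [1] and [a + b + 1], and shares only one edge with each, so
    an edge remains free. *)
Lemma fork_outer_edge i : exists x y, fork_arc i x y /\ forall j, fork_arc j y x -> j < i.
Proof.
have [i0|i0] := posnP (i : nat); last first.
  have pi : p i < i by apply: fork_parent_lt.
  have [x [y [xy yx]]] := fork_parent_edge pi; exists x, y; split=> // j yx'.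
  by rewrite (fork_arc_uniq yx' yx).
have [x [y xy]] := fork_arc_triangle i; have [z [u tE E]] := fork_arcP xy.
have yz : fork_arc i y z by rewrite E !inE eqxx orbT.
have zx : fork_arc i z x by rewrite E !inE eqxx !orbT.
pose out v w := [forall j, fork_arc j w v ==> (j < i)].
have outP v w : reflect (forall j, fork_arc j w v -> j < i) (out v w).
  by apply: (iffP forallP) => H j; apply/implyP; exact: H.
have [/outP oxy|] := boolP (out x y); first by exists x, y.
have [/outP oyz|] := boolP (out y z); first by exists y, z.
have [/outP ozx|] := boolP (out z x); first by exists z, x.
have nb v w : fork_arc i v w -> ~~ out v w ->
    exists2 j, fork_arc j w v & (j = 1 :> nat) \/ (j = a + b + 1 :> nat).
  move=> vw /forallPn[j]; rewrite negb_imply -leqNgt => /andP[wv ij]; exists j => //.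
  have {ij} ij : i < j.
    rewrite ltn_neqAle ij andbT; apply: contraTneq wv => /ord_inj <-.
    have [t [tu _ tE']] := fork_arcP vw; rewrite tE' !inE !xpair_eqE.
    by move: tu; rewrite /= !inE; do ?case: eqP => //; congruence.
  have := congr1 (@nat_of_ord _) (fork_parent_adj vw wv ij); rewrite /= i0.
  by case: ifP => [/eqP -> _|_ j1]; [right|left; lia].
(* A triangle sharing two consecutive edges with the root would have the same three vertices. *)
have two j v w t : fork_arc i v w -> fork_arc i w t -> fork_arc j w v -> fork_arc j t w -> False.
  move=> vw wt wv tw; have [s [su sE sA]] := fork_arcP vw; have [s' [su' sE' sA']] := fork_arcP wv.
  have ts : t = s.
    move: wt su; rewrite sA /= !inE !xpair_eqE; do ?case: (_ =P _) => //=; congruence.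
  have ts' : t = s'.
    move: tw su'; rewrite sA' /= !inE !xpair_eqE; do ?case: (_ =P _) => //=; congruence.
  have ij : i = j by apply: f_inj; apply/setP => e; rewrite sE sE' -ts -ts' !inE orbCA.
  subst j; move: su; have := wv; rewrite sA /= !inE !xpair_eqE.
  by do ?case: (_ =P _) => //=; congruence.
move=> /(nb _ _ zx)[j3 a3 c3] /(nb _ _ yz)[j2 a2 c2] /(nb _ _ xy)[j1 a1 c1].
have : [\/ j1 = j2, j2 = j3 | j1 = j3].
  by case: c1 => c1; case: c2 => c2; case: c3 => c3;
    do ?[by constructor 1; apply: ord_inj; rewrite c1 c2|by constructor 2; apply: ord_inj; rewrite c2 c3
      |by constructor 3; apply: ord_inj; rewrite c1 c3].
case=> jj; subst.
- by case: (two _ _ _ _ xy yz a1 a2).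
- by case: (two _ _ _ _ yz zx a2 a3).
by case: (two _ _ _ _ zx xy a3 a1).
Qed.

Lemma fork_rooted_triangulation : rooted_triangulation D fork_arc p.
Proof.
split.
- exact: fork_arc_uniq.
- exact: fork_gedge.
- move=> i; have [x [y xy]] := fork_arc_triangle i; have [z [u _ E]] := fork_arcP xy.
  by exists x, y, z.
- exact: fork_parent_lt.
- exact: fork_parent_adj.
- exact: fork_parent_edge.
- exact: fork_new_vertex.
exact: fork_outer_edge.
Qed.
End DualFork.

(** * Transfer of the count to maximal separated collections *)

Theorem theorem9p6 (n a b : nat) (D : {set 'I_n.+2 * 'I_n.+2}) :
  2 <= n -> a + b + 2 = n ->
  triangulation D -> dual_iso_Tab D a b ->
  num_maximal_collections D
    (2 * (n + 1) * (n`! %/ (n - a)`!) * (n`! %/ (n - b)`!)).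
Proof.
move=> _ nE; subst n => trD [f [f_inj f_tri _ f_adj]].
have disk := fork_rooted_triangulation trD f_inj f_tri f_adj.
have [L [uL LP sL]] := fork_biclosed_count a b.
(* [compatible] is a bijection from the biclosed families of subtrees to the maximal separated
   collections. *)
exists [seq compatible D (fork_arc f) (@fork_parent a b) A | A <- L]; split.
- rewrite map_inj_in_uniq // => A B /LP[bA sA] /LP[bB sB].
  exact: (compatible_inj disk).
- move=> S; split=> [/mapP[A /LP[bA _] ->]|maxS]; first exact: (compatible_maximal disk).
  have [A [bA sA ->]] := maximal_compatible disk maxS.
  by apply/map_f/LP.
by rewrite size_map.
Qed.
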